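(* Let $n_1\le n_2$, $n_3$ and $1\le r\le n_1$ be integers, and let $\delta,\eta\in(0,1)$. There is a constant $C>0$ depending only on the subgaussian parameter $L$ such that, if $\Phi:\mathbb{R}^{n_1\times n_2\times n_3}\to\mathbb{R}^m$ is a random draw of an $L$-subgaussian measurement ensemble and $$m\ge C\,\delta^{-2}\max\{(r\cdot r\cdot n_3+n_1\cdot r\cdot n_3+n_2\cdot r\cdot n_3)\log 2,\ \log(\eta^{-1})\},$$ then with probability at least $1-\eta$ the TRIP constant of $\Phi$ satisfies $\delta_r\le\delta$.
   Context: Tubal rank $\mathrm{rank}_t(\mathcal{X})$: the number of nonzero singular tubes of the central f-diagonal factor in the t-SVD of $\mathcal{X}$ (equivalently, the maximum rank of the frontal slices of the DFT of $\mathcal{X}$ along the third dimension). TRIP: for a linear map $\Phi:\mathbb{R}^{n_1\times n_2\times n_3}\to\mathbb{R}^m$ and an integer $r$, the TRIP constant $\delta_r$ is the smallest $\delta\ge 0$ such that $(1-\delta)\|\mathcal{X}\|_F^2\le\|\Phi(\mathcal{X})\|_2^2\le(1+\delta)\|\mathcal{X}\|_F^2$ for all $\mathcal{X}$ with $\mathrm{rank}_t(\mathcal{X})\le r$. An $L$-subgaussian measurement ensemble is a random linear map $\Phi(\mathcal{X})=\frac{1}{\sqrt m}(\langle\mathcal{A}_1,\mathcal{X}\rangle,\dots,\langle\mathcal{A}_m,\mathcal{X}\rangle)$ where all entries of the tensors $\mathcal{A}_i\in\mathbb{R}^{n_1\times n_2\times n_3}$ are independent, mean-zero, unit-variance, $L$-subgaussian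 random variables. *)

(* Defs.v *)
From HB Require Import structures.
From mathcomp Require Import all_boot all_order all_algebra.
From mathcomp Require Import all_classical all_reals all_analysis.
From mathcomp Require Import complex.

Set Implicit Arguments.
Unset Strict Implicit.
Unset Printing Implicit Defensive.

Import Order.TTheory GRing.Theory Num.Theory.
Local Open Scope ring_scope.

Section Tensors.
Variable R : realType.

Definition tensor (n1 n2 n3 : nat) := 'I_n1 -> 'I_n2 -> 'I_n3 -> R.

Definition dft_root (n3 : nat) : R[i] :=
  Complex (cos (2 * pi / n3%:R)) (- sin (2 * pi / n3%:R)).

Definition dft_slice n1 n2 n3 (X : tensor n1 n2 n3) (k : 'I_n3)
  : 'M[R[i]]_(n1, n2) :=
  \matrix_(i < n1, j < n2)
     \sum_(l < n3) (Complex (X i j l) 0) * (dft_root n3) ^+ (k * l).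

Definition tubal_rank n1 n2 n3 (X : tensor n1 n2 n3) : nat :=
  \max_(k < n3) \rank (dft_slice X k).

Definition frob_sq n1 n2 n3 (X : tensor n1 n2 n3) : R :=
  \sum_(i < n1) \sum_(j < n2) \sum_(l < n3) X i j l ^+ 2.

Definition tinner n1 n2 n3 (A X : tensor n1 n2 n3) : R :=
  \sum_(i < n1) \sum_(j < n2) \sum_(l < n3) A i j l * X i j l.

Definition norm2_sq m (v : 'I_m -> R) : R := \sum_(p < m) v p ^+ 2.

Definition meas_map m n1 n2 n3 (A : 'I_m -> tensor n1 n2 n3)
  (X : tensor n1 n2 n3) : 'I_m -> R :=
  fun p => (Num.sqrt (m%:R))^-1 * tinner (A p) X.

Definition trip_const m n1 n2 n3 (r : nat)
  (Phi : tensor n1 n2 n3 -> ('I_m -> R)) : R :=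
  inf [set d : R | 0 <= d /\
    forall X : tensor n1 n2 n3, (tubal_rank X <= r)%N ->
      (1 - d) * frob_sq X <= norm2_sq (Phi X) <= (1 + d) * frob_sq X].

End Tensors.

Section Probability.
Local Open Scope classical_set_scope.
Local Open Scope ereal_scope.
Context d (T : measurableType d) (R : realType) (P : probability T R).

Definition mutually_independent (I : finType) (X : I -> {RV P >-> R}) : Prop :=
  forall (J : {set I}) (B : I -> set R), (forall j, measurable (B j)) ->
    P [set w | forall j, j \in J -> B j (X j w)] =
    \big[*%E/1%E]_(j in J) P (X j @^-1` B j).

Definition subgaussian (L : R) (X : {RV P >-> R}) : Prop :=
  forall t : R, 'M_P X t <= (expR (L ^+ 2 * t ^+ 2 / 2))%:E.

End Probability.

(* Main.v *)
(** The map is extended to complex tensors and read in the Fourier domain, where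
    low tubal rank means that every slice factors as [Q_k V_k] with inner
    dimension [r].  Put [B u v := <Phi u, Phi v> - <u, v>].

    For fixed [u] the squared coordinates of [Phi u] are independent with mean
    [|u|^2] and exponential moments controlled by [L], so Chernoff's bound gives
    [`|B u u| <= t |u|^2] outside an event of probability [2 exp (- c m t^2)].

    Normalising [V_k] to have orthonormal rows, round [V] and then [Q] to a
    lattice.  Rounding each coordinate up or down so as not to exceed the
    average over the two choices makes both [Q (V - V')] and [(Q - Q') V'] have
    norm at most [1/8], although the lattice has only [2 ^ O((n1 + n2) r n3)]
    relevant points; an operator-norm net is not needed.  These two errors again
    have rank [r], hence the supremum [s] of [`|B u v|] over low-rank unit [u, v]
    satisfies [s <= max_net `|B| + (9/16) s], and polarization together with a
    union bound controls [B] on the net. *)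
Require Import Defs.
From HB Require Import structures.
From mathcomp Require Import all_boot all_order all_algebra.
From mathcomp Require Import all_classical all_reals all_analysis.
From mathcomp Require Import complex.
From mathcomp Require Import measurable_realfun spectral.
From mathcomp Require Import ring lra zify.

Import Order.TTheory GRing.Theory Num.Theory.
Import numFieldNormedType.Exports.
Local Open Scope classical_set_scope.
Local Open Scope ring_scope.

(** * Independence *)

Section independence.
Context {d : measure_display} {T : measurableType d} {R : realType}.
Variable P : probability T R.

(** Tensors of tubal rank at most [r] are not closed under differences, and this shapes the
    argument. In [M - Q'V' = Q(V - V') + (Q - Q')V'] each summand has rank at most [r], while their
    sum may have rank [2r]. A bilinear form can be estimated on the summands one at a time, so the
    larger cone never appears. The polarized tensors [u + v] and [u - v] may leave the cone, but the
    tail bound holds for every fixed tensor.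

    Rounding destroys the conjugate symmetry between the Fourier slices of a real tensor. Net points
    are therefore complex after synthesis; [Phi] acts on their real and imaginary parts separately,
    and [B] sums the two contributions.

    The net is counted by a power of two, with no logarithm of the dimensions, because the lattice
    steps make the squared length of an integer code proportional to the number of its
    coordinates. *)

Lemma expectationM_indep2 (F G : T -> R) :
  measurable_fun setT F -> measurable_fun setT G ->
  (forall w, 0 <= F w) -> (forall w, 0 <= G w) ->
  (forall A B, measurable A -> measurable B ->
     P (F @^-1` A `&` G @^-1` B) = P (F @^-1` A) * P (G @^-1` B))%E ->
  ('E_P[fun w => (F w * G w)%R] = 'E_P[F] * 'E_P[G])%E.
Proof.
move=> mF mG F0 G0 indFG.
pose F' : {mfun T >-> R} := HB.pack F (isMeasurableFun.Build _ _ _ _ F mF).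
pose G' : {mfun T >-> R} := HB.pack G (isMeasurableFun.Build _ _ _ _ G mG).
pose H := fun w => (F w, G w).
have mH : measurable_fun setT H by exact: measurable_fun_pair.
pose H' : {mfun T >-> (R * R)%type} := HB.pack H (isMeasurableFun.Build _ _ _ _ H mH).
(* The absolute values make the integrand nonnegative on the whole plane, as Tonelli requires; at
   the values of [(F, G)] they change nothing. *)
pose f : R * R -> \bar R := fun z => ((`|z.1| * `|z.2|)%R)%:E.
have mf : measurable_fun setT f.
  apply/measurable_EFinP; apply: measurable_funM;
  by apply: measurableT_comp => //; apply: measurable_fst || apply: measurable_snd.
have f0 z : (0 <= f z)%E by rewrite lee_fin mulr_ge0.
rewrite unlock.
transitivity (\int[distribution P H']_z f z)%E.
  rewrite ge0_integral_distribution//; apply: eq_integral => w _ /=.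
  by rewrite /f /= !ger0_norm.
(* By independence the joint law agrees with the product law on rectangles, hence everywhere. *)
transitivity (\int[(distribution P F' \x distribution P G')%E]_z f z)%E.
  apply: eq_measure_integral => A mA _; symmetry.
  exact: product_measure_unique.
rewrite (fubini_tonelli1 f)//.
rewrite /fubini_F.
transitivity (\int[distribution P F']_x ((`|x|)%:E * \int[P]_w (G w)%:E))%E.
  apply: eq_integral => x _.
  transitivity (\int[distribution P G']_y ((`|x|)%:E * (`|y|)%:E))%E.
    by apply: eq_integral => y _; rewrite /f/= EFinM.
  rewrite ge0_integralZl//; last first.
    by apply/measurable_EFinP; exact: normr_measurable.
  congr (_ * _)%E; rewrite ge0_integral_distribution//; last first.
    by apply/measurable_EFinP; exact: normr_measurable.
  by apply: eq_integral => w _ /=; rewrite ger0_norm.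
rewrite ge0_integralZr//; last 2 first.
- by apply/measurable_EFinP; exact: normr_measurable.
- by apply: integral_ge0 => w _; rewrite lee_fin.
congr (_ * _)%E; rewrite ge0_integral_distribution//; last first.
  by apply/measurable_EFinP; exact: normr_measurable.
by apply: eq_integral => w _ /=; rewrite ger0_norm.
Qed.

Context {I : finType}.
Variable a : I -> {RV P >-> R}.

(** A pi-system generating the sigma-algebra of the coordinates in [J]. Measurability on [TJ J]
    below expresses that a function depends on these coordinates only. *)
Definition cylinders (J : {set I}) : set (set T) :=
  [set E | exists B : I -> set R, (forall j, measurable (B j)) /\
     E = [set w | forall j, j \in J -> B j (a j w)]].

Lemma cylinders_measurable J : cylinders J `<=` measurable.
Proof.
move=> _ [B [mB ->]].
rewrite (_ : [set w | _] = \bigcap_(j in [set` J]) (a j @^-1` B j)); last first.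
  by apply/seteqP; split=> w h j /=; exact: h.
apply: fin_bigcap_measurable; first exact: finite_finset.
by move=> j _; exact: measurable_funPTI.
Qed.

Lemma cylinders_setI J : setI_closed (cylinders J).
Proof.
move=> _ _ [B [mB ->]] [C [mC ->]].
exists (fun j => B j `&` C j); split; first by move=> j; exact: measurableI.
apply/seteqP; split=> w /=.
  by case=> hB hC j jJ; split; [exact: hB|exact: hC].
by move=> h; split=> j jJ; case: (h j jJ).
Qed.

Lemma cylindersT J : cylinders J setT.
Proof. by exists (fun=> setT); split => //; apply/seteqP; split. Qed.

Lemma sigma_cylinders_measurable J E : <<s cylinders J >> E -> measurable E.
Proof. by apply: smallest_sub; [exact: sigma_algebra_measurable|exact: cylinders_measurable]. Qed.

(** The finite measures [E |-> P (E & D)] and [E |-> P E P D] agree on a pi-system containing the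
    whole space, hence on the sigma-algebra it generates. *)
Lemma indep_sigma_extend (G : set (set T)) (D : set T) : G `<=` measurable ->
  setI_closed G -> G setT -> measurable D ->
  (forall E, G E -> P (E `&` D) = (P E * P D)%E) ->
  forall E, <<s G >> E -> P (E `&` D) = (P E * P D)%E.
Proof.
move=> mG GI GT mD h E sE.
have PDfin : P D \is a fin_num by exact: fin_num_measure.
have c0 : 0 <= fine (P D) by exact: fine_ge0.
pose m2 := mscale (NngNum c0) P.
have <- : m2 E = (P E * P D)%E by rewrite /m2 /mscale/= fineK// muleC.
apply: (g_sigma_algebra_measure_unique G mG (fun=> setT) _ _ (mrestr P mD) m2) => //=.
- by apply/seteqP; split => // x _; exists 0%N.
- by move=> A GA; rewrite /mrestr h// /mscale/= fineK// muleC.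
- by move=> _; rewrite /mrestr setTI (le_lt_trans (probability_le1 _ _)) ?ltry.
Qed.

Hypothesis ind : mutually_independent a.

(** The extension lemma is applied once per side. For two cylinders, disjointness lets the families
    be glued into one family [D] over the union, where mutual independence gives the product. *)
Lemma indep_sigma_cylinders (J1 J2 : {set I}) E1 E2 : disjoint (mem J1) (mem J2) ->
  <<s cylinders J1 >> E1 -> <<s cylinders J2 >> E2 ->
  P (E1 `&` E2) = (P E1 * P E2)%E.
Proof.
move=> dJ sE1 sE2.
apply: (indep_sigma_extend _ _ (cylinders_measurable J1) (cylinders_setI J1) (cylindersT J1)) => //.
  exact: sigma_cylinders_measurable sE2.
move=> E GE; rewrite setIC muleC.
apply: (indep_sigma_extend _ _ (cylinders_measurable J2) (cylinders_setI J2) (cylindersT J2)) => //.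
  exact: cylinders_measurable GE.
move=> _ [C [mC ->]]; case: GE => B [mB ->].
pose D j := if j \in J1 then B j else C j.
have mD j : measurable (D j) by rewrite /D; case: ifP.
have -> : [set w | forall j, j \in J2 -> C j (a j w)] `&`
          [set w | forall j, j \in J1 -> B j (a j w)] =
          [set w | forall j, j \in J2 :|: J1 -> D j (a j w)].
  apply/seteqP; split=> w /=.
    move=> [hC hB] j; rewrite inE /D.
    by case: ifP => [j1 _|_ /orP[j2|//]]; [exact: hB|exact: hC].
  move=> h; split=> j jJ; have := h j; rewrite inE jJ ?orbT /D.
    by rewrite ifF//; [exact|apply/negbTE; rewrite (disjointFl dJ)].
  by rewrite jJ; exact.
rewrite (ind (J2 :|: J1) D mD) (ind J1 B mB) (ind J2 C mC).
rewrite (bigID (mem J2))/=; congr (_ * _)%E.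
  apply: eq_big => [j|j /andP[_ j2]]; first by rewrite inE; case: (j \in J2); rewrite ?orbT ?andbF.
  by rewrite /D (disjointFl dJ).
apply: eq_big => [j|j]; rewrite inE.
  case: (boolP (j \in J2)) => /= j2; last by rewrite andbT.
  by rewrite (disjointFl dJ).
by move=> /andP[/orP[->//|j1] _]; rewrite /D j1.
Qed.

Local Notation TJ J := (g_sigma_algebraType (cylinders J)).

Lemma measurable_coord (J : {set I}) j : j \in J ->
  measurable_fun [set: TJ J] (a j : TJ J -> R).
Proof.
move=> jJ _ B mB; rewrite setTI; apply: sub_sigma_algebra.
exists (fun i => if i == j then B else setT); split; first by move=> i; case: ifP.
apply/seteqP; split=> w /=; first by move=> ? i _; case: eqP => [->|].
by move=> /(_ j jJ); rewrite eqxx.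
Qed.

Lemma measurable_coarse (J : {set I}) (F : T -> R) :
  measurable_fun [set: TJ J] (F : TJ J -> R) -> measurable_fun setT F.
Proof.
move=> mF _ B mB; have := mF measurableT B mB; rewrite !setTI.
exact: sigma_cylinders_measurable.
Qed.

Lemma measurable_finer (J J' : {set I}) (F : T -> R) : J \subset J' ->
  measurable_fun [set: TJ J] (F : TJ J -> R) ->
  measurable_fun [set: TJ J'] (F : TJ J' -> R).
Proof.
move=> sJ mF _ B mB; have := mF measurableT B mB; rewrite !setTI.
move: (F @^-1` B); apply: smallest_sub; first exact: smallest_sigma_algebra.
move=> _ [C [mC ->]]; apply: sub_sigma_algebra.
exists (fun i => if i \in J then C i else setT); split; first by move=> i; case: ifP.
apply/seteqP; split=> w /= h j jJ; first by case: ifP => // /h.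
by have := h j (fintype.subsetP sJ j jJ); rewrite jJ.
Qed.

(** Induction on a list of blocks: the product over the remaining blocks is measurable for their
    union [K], which is disjoint from the current block. Nonnegativity dispenses with
    integrability. *)
Lemma expectation_prod_indep {S : finType} (J : S -> {set I}) (F : S -> T -> R) :
  (forall s s', s != s' -> disjoint (mem (J s)) (mem (J s'))) ->
  (forall s, measurable_fun [set: TJ (J s)] (F s : TJ (J s) -> R)) ->
  (forall s w, 0 <= F s w) ->
  ('E_P[fun w => (\prod_s F s w)%R] = \prod_s 'E_P[F s])%E.
Proof.
move=> dJ mF F0.
suff h (r : seq S) : uniq r ->
    ('E_P[fun w => (\prod_(s <- r) F s w)%R] = \prod_(s <- r) 'E_P[F s])%E.
  by rewrite -[RHS]h ?index_enum_uniq.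
elim: r => [_|s r IH /andP[sr ur]].
  rewrite big_nil (_ : (fun w => _) = cst 1) ?expectation_cst//.
  by apply/funext => w; rewrite big_nil.
rewrite big_cons -IH//.
rewrite (_ : (fun w => _) = (fun w => F s w * \prod_(s' <- r) F s' w)); last first.
  by apply/funext => w; rewrite big_cons.
pose K := \bigcup_(s' <- r) J s'.
have mr : measurable_fun [set: TJ K] ((fun w => \prod_(s' <- r) F s' w) : TJ K -> R).
  apply: measurable_prod => s' s'r; apply: measurable_finer (mF s').
  by rewrite /K (big_rem s')//= finset.subsetUl.
apply: expectationM_indep2 => //.
- exact: measurable_coarse (mF s).
- exact: measurable_coarse mr.
- by move=> w; apply: prodr_ge0.
- move=> A B mA mB; apply: (@indep_sigma_cylinders (J s) K).
  + rewrite /K disjoint_sym big_seq; elim/big_ind : _ => [|A' B' dA dB|s' s'r].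
    * by rewrite finset.disjoints_subset finset.sub0set.
    * by move: dA dB; rewrite !finset.disjoints_subset finset.subUset => -> ->.
    * by apply: dJ; apply: contraNneq sr => <-.
  + by have := mF s measurableT A mA; rewrite setTI.
  + by have := mr measurableT B mB; rewrite setTI.
Qed.
End independence.

(** * Squares of subgaussian variables *)

Section scalar_exponential.
Variable R : realType.
Implicit Types u v y c : R.

(** The linear term is kept exact so that it can cancel under a centred expectation. Only
    [1 + x <= expR x] at [u] and [- u] is used. *)
Lemma expR_le_quadratic u : expR u <= 1 + u + u ^+ 2 * expR `|u|.
Proof.
have e0 := expR_gt0 u; have e1 := expR_ge1Dx u; have e2 := expR_ge1Dx (- u).
have em : expR u * expR (- u) = 1 by rewrite -expRD subrr expR0.
have [u0|u0] := leP 0 u.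
  rewrite ger0_norm//.
  have h : expR u - 1 <= u * expR u by nra.
  by nra.
rewrite ltr0_norm//.
have h : 1 - expR u <= - u by lra.
have h2 : expR u - 1 - u <= u ^+ 2 by nra.
have h3 : 1 <= expR (- u) by lra.
by have := sqr_ge0 u; nra.
Qed.

Lemma sqr_le_expR v : 0 <= v -> v ^+ 2 <= 4 * expR v.
Proof.
move=> v0; have -> : expR v = expR (v / 2) ^+ 2.
  by rewrite expr2 -expRD; congr expR; lra.
have := expR_ge1Dx (v / 2); nra.
Qed.

Lemma sqr_le_scaled (k z e : R) : 0 < k ->
  (k / 2 * z) ^+ 2 <= 4 * e -> z ^+ 2 <= 16 / k ^+ 2 * e.
Proof.
move=> k0 h; rewrite mulrAC ler_pdivlMr ?exprn_gt0//.
by move: h; rewrite exprMn; lra.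
Qed.

(** The right-hand side has the shape of the geometric series summed by [epsilon_trick0]. *)
Lemma expR_natN_le (k : nat) : expR (- (k%:R ^+ 2)) <= 2 / (2 ^ k.+1)%:R :> R.
Proof.
have e1 : (2 : R) <= expR 1 by have := expR_ge1Dx (1 : R); lra.
have -> : 2 / (2 ^ k.+1)%:R = (2 ^+ k)^-1 :> R.
  by rewrite expnS natrM natrX invfM mulrA divff ?mul1r.
rewrite expRN lef_pV2 ?posrE ?expR_gt0 ?exprn_gt0//.
apply: (@le_trans _ _ (expR k%:R)).
  by rewrite -[k%:R]mulr1 expRM_natl lerXn2r ?nnegrE ?expR_ge0.
rewrite ler_expR -natrX ler_nat; case: (k) => // n.
by rewrite -[X in (X <= _)%N]expn1 leq_pexp2l.
Qed.

(* The Gaussian exponential is dominated, up to the constant [expR c], by the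
   term of the discrete sum whose index is the integer part of [`|y| / (2c)]. *)
Lemma expR_sqr_le_discrete c y : 0 < c -> exists k : nat,
  expR (y ^+ 2 / (4 * c)) <=
  expR c * ((expR (k%:R * y) + expR (- (k%:R * y))) * expR (- (c * k%:R ^+ 2))).
Proof.
move=> c0; pose u := `|y| / (2 * c); pose k := Num.trunc u.
have u0 : 0 <= u by rewrite divr_ge0// mulr_ge0// ltW.
have k1 : k%:R <= u by rewrite truncn_le.
have k2 : u < k%:R + 1 by rewrite natr1 truncnS_gt.
have yE : `|y| = 2 * c * u by rewrite /u mulrC divfK// gt_eqF// mulr_gt0.
exists k.
apply: (@le_trans _ _ (expR c * (expR (k%:R * `|y|) * expR (- (c * k%:R ^+ 2))))).
  rewrite -!expRD ler_expR -real_normK ?num_real// yE.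
  have -> : (2 * c * u) ^+ 2 / (4 * c) = c * u ^+ 2 by field; lra.
  rewrite -subr_ge0.
  (* Completing the square leaves only [u - k], which lies between 0 and 1. *)
  have -> : c + (k%:R * (2 * c * u) - c * k%:R ^+ 2) - c * u ^+ 2 = c * (1 - (u - k%:R) ^+ 2) by ring.
  by rewrite mulr_ge0 ?(ltW c0)//; nra.
rewrite ler_wpM2l ?expR_ge0// ler_wpM2r ?expR_ge0//.
have [y0|y0] := leP 0 y; first by rewrite ger0_norm// lerDl expR_ge0.
by rewrite ltr0_norm// mulrN lerDr expR_ge0.
Qed.

End scalar_exponential.

Section subgaussian_square.
Context {d : measure_display} {T : measurableType d} {R : realType}.
Variable P : probability T R.

(** The summand 1 leaves a factor [expR (- k ^+ 2)] after the weight [expR (- (c k ^+ 2))] has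
    absorbed the moment bound at [k]. [sg_kappa] is then the exponent for which [Y ^+ 2] has a
    finite exponential moment, and [sg_C] the quadratic rate of the centred square. *)
Definition sg_c (L : R) : R := L ^+ 2 / 2 + 1.
Definition sg_kappa (L : R) : R := (4 * sg_c L)^-1.
Definition sg_C (L : R) : R :=
  16 / sg_kappa L ^+ 2 * expR (sg_kappa L) * (4 * expR (sg_c L)).

Lemma sg_c_gt0 L : 0 < sg_c L.
Proof. by rewrite /sg_c; have := sqr_ge0 L; lra. Qed.

Lemma sg_kappa_gt0 L : 0 < sg_kappa L.
Proof. by rewrite invr_gt0 mulr_gt0// sg_c_gt0. Qed.

Lemma sg_C_gt0 L : 0 < sg_C L.
Proof.
by rewrite /sg_C !mulr_gt0 ?expR_gt0// invr_gt0 exprn_gt0// sg_kappa_gt0.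
Qed.

(** A discrete substitute for averaging [expR (s Y)] over a Gaussian [s]: the integrand is dominated
    by a series in [expR (k Y)] and [expR (- (k Y))]. By subgaussianity at [k] and [- k] its terms
    integrate to at most [4 expR c / 2 ^ k.+1]. *)
Lemma integral_expR_sqr_subgaussian (L : R) (Y : T -> R) :
  measurable_fun setT Y ->
  (forall s : R, \int[P]_w (expR (s * Y w))%:E <= (expR (L ^+ 2 * s ^+ 2 / 2))%:E)%E ->
  (\int[P]_w (expR (sg_kappa L * Y w ^+ 2))%:E <= (4 * expR (sg_c L))%:E)%E.
Proof.
move=> mY sgY; set c := sg_c L.
have c0 : 0 < c := sg_c_gt0 L.
pose f (k : nat) w := expR c * ((expR (k%:R * Y w) + expR (- (k%:R * Y w))) * expR (- (c * k%:R ^+ 2))).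
have f0 k w : 0 <= f k w by rewrite !mulr_ge0 ?addr_ge0 ?expR_ge0.
have mexp s : measurable_fun setT (fun w => expR (s * Y w)).
  by apply: measurableT_comp => //; exact: measurable_funM.
have mexpN s : measurable_fun setT (fun w => expR (- (s * Y w))).
  by under eq_fun do rewrite -mulNr; exact: mexp.
have mf k : measurable_fun setT (fun w => (f k w)%:E).
  apply/measurable_EFinP; apply: measurable_funM => //; apply: measurable_funM => //.
  by apply: measurable_funD.
have fle w : ((expR (sg_kappa L * Y w ^+ 2))%:E <= \sum_(0 <= k <oo) (f k w)%:E)%E.
  have [k hk] := expR_sqr_le_discrete _ c (Y w) c0.
  have -> : sg_kappa L * Y w ^+ 2 = Y w ^+ 2 / (4 * c) by rewrite mulrC.
  apply: (@le_trans _ _ (f k w)%:E); first by rewrite lee_fin.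
  apply: le_trans (nneseries_lim_ge k.+1 _); last by move=> n _ _; rewrite lee_fin.
  by rewrite big_nat_recr//= leeDr// sume_ge0// => i _; rewrite lee_fin.
have fint k : (\int[P]_w (f k w)%:E <= (4 * expR c / (2 ^ k.+1)%:R)%:E)%E.
  rewrite (eq_integral (fun w => (expR c * expR (- (c * k%:R ^+ 2)))%:E *
     ((expR (k%:R * Y w))%:E + (expR ((- k%:R) * Y w))%:E))%E); last first.
    by move=> w _; rewrite -EFinD -EFinM /f mulNr; congr (_%:E); ring.
  rewrite ge0_integralZl//; last 2 first.
  - by apply: emeasurable_funD; apply/measurable_EFinP; exact: mexp.
  - by move=> w _; rewrite -EFinD lee_fin addr_ge0 ?expR_ge0.
  rewrite ge0_integralD//; last 2 first.
  - by apply/measurable_EFinP; exact: mexp.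
  - by apply/measurable_EFinP; exact: mexp.
  apply: (@le_trans _ _ ((expR c * expR (- (c * k%:R ^+ 2)))%:E *
     ((expR (L ^+ 2 * k%:R ^+ 2 / 2))%:E + (expR (L ^+ 2 * k%:R ^+ 2 / 2))%:E))%E).
    rewrite lee_wpmul2l ?lee_fin ?mulr_ge0 ?expR_ge0//.
    by apply: leeD; [exact: sgY|rewrite -(sqrrN k%:R); exact: sgY].
  rewrite -EFinD -EFinM lee_fin.
  have -> : expR c * expR (- (c * k%:R ^+ 2)) *
      (expR (L ^+ 2 * k%:R ^+ 2 / 2) + expR (L ^+ 2 * k%:R ^+ 2 / 2)) =
      2 * expR c * expR (- (k%:R ^+ 2)).
    have <- : expR (- (c * k%:R ^+ 2)) * expR (L ^+ 2 * k%:R ^+ 2 / 2) = expR (- (k%:R ^+ 2)).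
      by rewrite -expRD; congr expR; rewrite /c /sg_c; ring.
    ring.
  have := expR_natN_le R k; have := expR_gt0 c.
  set e := expR c; set x := expR _; set z := (_ ^ _)%:R => e0 hx.
  have -> : 4 * e / z = 2 * e * (2 / z) by ring.
  by rewrite ler_wpM2l// mulr_ge0// ltW.
apply: (@le_trans _ _ (\int[P]_w \sum_(0 <= k <oo) (f k w)%:E)%E).
  apply: ge0_le_integral => //.
  - apply/measurable_EFinP; apply: measurableT_comp => //.
    by apply: measurable_funM => //; exact: measurable_funX.
  - by apply: ge0_emeasurable_sum => // k w _ _; rewrite lee_fin.
rewrite integral_nneseries//; last by move=> k w _; rewrite lee_fin.
apply: le_trans (epsilon_trick0 xpredT (_ : 0 <= 4 * expR c)); last first.
  by rewrite mulr_ge0 ?expR_ge0.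
apply: lee_nneseries => //.
by move=> k _ _; apply: integral_ge0 => w _; rewrite lee_fin.
Qed.

(** In the quadratic bound for the exponential the linear term integrates to zero. With
    [Z = Y ^+ 2 - 1], half of the exponent [kappa] pays for the factor [Z ^+ 2], the other half for
    [expR (l Z)], and [|Z| <= Y ^+ 2 + 1] yields the factor [expR kappa]. *)
Lemma integral_expR_centered_square (L l : R) (Y : T -> R) :
  measurable_fun setT Y ->
  (forall s : R, \int[P]_w (expR (s * Y w))%:E <= (expR (L ^+ 2 * s ^+ 2 / 2))%:E)%E ->
  (\int[P]_w (Y w ^+ 2)%:E = 1)%E -> `|l| <= sg_kappa L / 2 ->
  (\int[P]_w (expR (l * (Y w ^+ 2 - 1)))%:E <= (expR (sg_C L * l ^+ 2))%:E)%E.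
Proof.
move=> mY sgY Y2 ll; set k := sg_kappa L in ll *.
have k0 : 0 < k := sg_kappa_gt0 L.
have mY2 : measurable_fun setT (fun w => Y w ^+ 2) by exact: measurable_funX.
pose D := l ^+ 2 * (16 / k ^+ 2 * expR k).
have D0 : 0 <= D.
  by rewrite /D mulr_ge0 ?sqr_ge0// mulr_ge0 ?expR_ge0// divr_ge0// sqr_ge0.
pose Q w := D * expR (k * Y w ^+ 2).
have mQ : measurable_fun setT Q.
  apply: measurable_funM => //; apply: measurableT_comp => //.
  exact: measurable_funM.
have Q0 w : 0 <= Q w by rewrite mulr_ge0 ?expR_ge0.
have ptw w : expR (l * (Y w ^+ 2 - 1)) <= 1 + l * (Y w ^+ 2 - 1) + Q w.
  apply: le_trans (expR_le_quadratic _ _) _; rewrite lerD2l /Q /D.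
  set Z := Y w ^+ 2 - 1; rewrite normrM exprMn -[leLHS]mulrA -[leRHS]mulrA ler_wpM2l ?sqr_ge0//.
  have Z0 := normr_ge0 Z.
  have hz : (k / 2 * `|Z|) ^+ 2 <= 4 * expR (k / 2 * `|Z|).
    by apply: sqr_le_expR; rewrite mulr_ge0// divr_ge0// ltW.
  have z2 : Z ^+ 2 <= 16 / k ^+ 2 * expR (k / 2 * `|Z|).
    by rewrite -(real_normK (num_real Z)); exact: sqr_le_scaled.
  apply: (@le_trans _ _ (16 / k ^+ 2 * expR (k / 2 * `|Z|) * expR (`|l| * `|Z|))).
    by rewrite ler_wpM2r ?expR_ge0.
  rewrite -[leLHS]mulrA -[leRHS]mulrA; apply: ler_wpM2l; first by rewrite divr_ge0 ?sqr_ge0.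
  rewrite -!expRD ler_expR.
  have ZY : `|Z| <= Y w ^+ 2 + 1.
    by rewrite /Z ler_norml; have := sqr_ge0 (Y w); lra.
  nra.
(* Positive and negative parts of [l] (here [ln] is not the logarithm): moving each signed term to
   the side where it is nonnegative leaves only integrals of nonnegative functions. *)
pose lp : R := Num.max l 0; pose ln : R := Num.max (- l) 0.
have lam_eq w : expR (l * (Y w ^+ 2 - 1)) + lp + ln * Y w ^+ 2 <=
   1 + ln + lp * Y w ^+ 2 + Q w.
  by have := ptw w; rewrite /lp /ln; case: (lerP l 0) => l0; case: (lerP (-l) 0) => l0'; nra.
have lp0 : 0 <= lp by rewrite le_max lexx orbT.
have ln0 : 0 <= ln by rewrite le_max lexx orbT.
have mE : measurable_fun setT (fun w => expR (l * (Y w ^+ 2 - 1))).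
  apply: measurableT_comp => //; apply: measurable_funM => //.
  exact: measurable_funB.
have IQ : (\int[P]_w (Q w)%:E <= (sg_C L * l ^+ 2)%:E)%E.
  rewrite (eq_integral (fun w => D%:E * (expR (k * Y w ^+ 2))%:E)%E); last first.
    by move=> w _; rewrite -EFinM.
  rewrite ge0_integralZl_EFin//=; last first.
    by apply/measurable_EFinP; apply: measurableT_comp => //; exact: measurable_funM.
  apply: (@le_trans _ _ (D%:E * (4 * expR (sg_c L))%:E)%E).
    by apply: lee_wpmul2l; rewrite ?lee_fin//; exact: integral_expR_sqr_subgaussian.
  by rewrite -EFinM lee_fin /D /sg_C -/k le_eqVlt; apply/orP; left; apply/eqP; ring.
have main : (\int[P]_w (expR (l * (Y w ^+ 2 - 1)))%:E + lp%:E + ln%:E <=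
    (1 + ln)%:E + lp%:E + \int[P]_w (Q w)%:E)%E.
  have cstI (r : R) : (\int[P]_w r%:E = r%:E)%E.
    by rewrite integral_cst//= probability_setT mule1.
  have I1 (r : R) : 0 <= r -> (\int[P]_w (r * Y w ^+ 2)%:E = r%:E)%E.
    move=> r0; under eq_integral do rewrite EFinM.
    rewrite ge0_integralZl_EFin//= ?Y2 ?mule1//.
    - by move=> w _; rewrite lee_fin sqr_ge0.
    - exact/measurable_EFinP.
  have ID (f g : T -> R) : measurable_fun setT f -> measurable_fun setT g -> (forall w, 0 <= f w) ->
      (forall w, 0 <= g w) -> (\int[P]_w (f w + g w)%:E = \int[P]_w (f w)%:E + \int[P]_w (g w)%:E)%E.
    move=> mf mg f0 g0; under eq_integral do rewrite EFinD.
    by rewrite ge0_integralD//=; do ?[by move=> w _; rewrite lee_fin|exact/measurable_EFinP].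
  have mr (r : R) : measurable_fun setT (fun w => r * Y w ^+ 2) by exact: measurable_funM.
  have r0 (r : R) w : 0 <= r -> 0 <= r * Y w ^+ 2 by move=> ?; rewrite mulr_ge0 ?sqr_ge0.
  have -> : (\int[P]_w (expR (l * (Y w ^+ 2 - 1)))%:E + lp%:E + ln%:E =
     \int[P]_w (expR (l * (Y w ^+ 2 - 1)) + lp + ln * Y w ^+ 2)%:E)%E.
    rewrite (ID (fun w => expR (l * (Y w ^+ 2 - 1)) + lp)) ?ID ?I1 ?cstI//;
      try exact: measurable_funD; by move=> w; rewrite ?addr_ge0 ?r0 ?expR_ge0.
  have -> : ((1 + ln)%:E + lp%:E + \int[P]_w (Q w)%:E =
     \int[P]_w (1 + ln + lp * Y w ^+ 2 + Q w)%:E)%E.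
    rewrite (ID (fun w => 1 + ln + lp * Y w ^+ 2)) ?ID ?I1 ?cstI//;
      try exact: measurable_funD; by move=> w; rewrite ?addr_ge0 ?r0.
  apply: ge0_le_integral => //.
  - by move=> w _; rewrite lee_fin !addr_ge0 ?expR_ge0 ?r0.
  - by apply/measurable_EFinP; apply: measurable_funD => //; exact: measurable_funD.
  - apply/measurable_EFinP; apply: measurable_funD => //; exact: measurable_funD.
  - by move=> w _; rewrite lee_fin.
have : (\int[P]_w (expR (l * (Y w ^+ 2 - 1)))%:E + lp%:E + ln%:E <=
    (1 + ln)%:E + lp%:E + (sg_C L * l ^+ 2)%:E)%E.
  by apply: le_trans main _; rewrite leeD2l.
rewrite -!EFinD -addeA -EFinD -leeBrDr// -EFinB => /le_trans; apply.
rewrite lee_fin; have := expR_ge1Dx (sg_C L * l ^+ 2); lra.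
Qed.

End subgaussian_square.

(** * Linear forms in independent variables *)

Section linear_forms.
Context {d : measure_display} {T : measurableType d} {R : realType}.
Variable P : probability T R.
Context {I : finType}.
Variables (L : R) (a : I -> {RV P >-> R}).
Hypothesis ind : mutually_independent a.
Hypothesis mean0 : forall q, ('E_P[a q] = 0)%E.
Hypothesis var1 : forall q, ('V_P[a q] = 1)%E.
Hypothesis sg : forall q, subgaussian L (a q).

Local Notation TJ J := (g_sigma_algebraType (cylinders P a J)).

Definition linform (x : I -> R) (w : T) : R := \sum_q x q * a q w.

Lemma measurable_linform x : measurable_fun setT (linform x).
Proof. by apply: measurable_sum => q; exact: measurable_funM. Qed.

Lemma measurable_linform_cylinders (x : I -> R) (J : {set I}) :
  (forall q, q \notin J -> x q = 0) ->
  measurable_fun [set: TJ J] (linform x : TJ J -> R).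
Proof.
move=> x0; apply: measurable_sum => q.
have [qJ|qJ] := boolP (q \in J).
  by apply: measurable_funM => //; exact: measurable_coord.
by rewrite (_ : (fun w => _) = cst 0)//; apply/funext => w; rewrite x0// mul0r.
Qed.

Lemma mgf_linform (x : I -> R) :
  (\int[P]_w (expR (linform x w))%:E <= (expR (L ^+ 2 / 2 * \sum_q x q ^+ 2))%:E)%E.
Proof.
have -> : (\int[P]_w (expR (linform x w))%:E =
           'E_P[fun w => (\prod_q expR (x q * a q w))%R])%E.
  by rewrite unlock; apply: eq_integral => w _; rewrite /linform expR_sum.
rewrite (expectation_prod_indep P a ind (fun q => [set q]%SET)); last 3 first.
- move=> s s' ss'; rewrite finset.disjoints_subset finset.sub1set !inE.
  by rewrite ss'.
- move=> q; apply: measurableT_comp => //; apply: measurable_funM => //.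
  by apply: measurable_coord; rewrite inE.
- by move=> q w; exact: expR_ge0.
rewrite mulr_sumr expR_sum -prodEFin.
(* Nonnegativity is carried through the induction because inequalities can only be multiplied
   between nonnegative extended reals. *)
suff : (0 <= \prod_q 'E_P[fun w => expR (x q * a q w)] <=
   \prod_q (expR (L ^+ 2 / 2 * x q ^+ 2))%:E)%E by case/andP.
elim/big_ind2 : _ => [|x1 x2 y1 y2 /andP[? ?] /andP[? ?]|q _].
- by rewrite lexx lee_fin ler01.
- by rewrite mule_ge0//= lee_pmul.
rewrite expectation_ge0/=; last by move=> w; exact: expR_ge0.
have -> : L ^+ 2 / 2 * x q ^+ 2 = L ^+ 2 * x q ^+ 2 / 2 by ring.
apply: le_trans (sg q (x q)); rewrite /mmt_gen_fun le_eqVlt; apply/orP; left; apply/eqP.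
by congr expectation; apply/funext => w /=; rewrite mulrC.
Qed.

Lemma integral_sqr_coord q : (\int[P]_w (a q w ^+ 2)%:E = 1)%E.
Proof.
have := var1 q; rewrite /variance unlock mean0/= unlock => <-.
by apply: eq_integral => w _; rewrite !fctE /= subr0 expr2.
Qed.

Lemma integrable_coord_prod q q' : P.-integrable setT (fun w => (a q w * a q' w)%:E).
Proof.
apply/integrableP; split.
  by apply/measurable_EFinP; exact: measurable_funM.
apply: (@le_lt_trans _ _ (\int[P]_w ((a q w ^+ 2)%:E + (a q' w ^+ 2)%:E))%E).
  apply: ge0_le_integral => //.
  - by apply: measurableT_comp => //; apply/measurable_EFinP; exact: measurable_funM.
  - by apply: emeasurable_funD; apply/measurable_EFinP; exact: measurable_funX.
  - move=> w _; rewrite -EFinD lee_fin normrM.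
    rewrite -(real_normK (num_real (a q w))) -(real_normK (num_real (a q' w))).
    have := sqr_ge0 (`|a q w| - `|a q' w|); have := normr_ge0 (a q w); have := normr_ge0 (a q' w).
    nra.
rewrite ge0_integralD//.
- by rewrite !integral_sqr_coord -EFinD ltry.
- by move=> w _; rewrite lee_fin sqr_ge0.
- by apply/measurable_EFinP; exact: measurable_funX.
- by move=> w _; rewrite lee_fin sqr_ge0.
- by apply/measurable_EFinP; exact: measurable_funX.
Qed.

Lemma integrable_coord q : P.-integrable setT (fun w => (a q w)%:E).
Proof.
apply/integrableP; split; first exact/measurable_EFinP.
apply: (@le_lt_trans _ _ (\int[P]_w (1 + (a q w ^+ 2)%:E))%E).
  apply: ge0_le_integral => //.
  - by apply: measurableT_comp => //; apply/measurable_EFinP.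
  - by apply: emeasurable_funD => //; apply/measurable_EFinP; exact: measurable_funX.
  - move=> w _; rewrite -EFinD lee_fin -(real_normK (num_real (a q w))).
    have := sqr_ge0 (`|a q w| - 1); have := normr_ge0 (a q w); nra.
rewrite ge0_integralD//.
- by rewrite integral_sqr_coord integral_cst//= probability_setT mule1 -EFinD ltry.
- by move=> w _; rewrite lee_fin sqr_ge0.
- by apply/measurable_EFinP; exact: measurable_funX.
Qed.

(** The product rule above covers nonnegative functions, so each variable is split into its positive
    part [f false] and negative part [f true]. Mean zero makes the two parts equal in expectation;
    hence the four products have the same expectation and cancel. *)
Lemma integral_coord_prod q q' : q != q' -> (\int[P]_w (a q w * a q' w)%:E = 0)%E.
Proof.
move=> qq'.
pose f (b : bool) s w := Num.max ((-1) ^+ b * a s w) 0.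
have f0 b s w : 0 <= f b s w by rewrite le_max lexx orbT.
have fE s w : a s w = f false s w - f true s w.
  rewrite /f expr0 expr1 mul1r mulN1r.
  by case: (lerP (a s w) 0) => h; case: (lerP (- a s w) 0) => h'; lra.
have mf b s (J : {set I}) : s \in J -> measurable_fun [set: TJ J] (f b s : TJ J -> R).
  move=> sJ; apply: measurable_maxr => //; apply: measurable_funM => //.
  exact: measurable_coord.
have mfT b s : measurable_fun setT (f b s).
  by apply: (measurable_coarse P a [set s]%SET); apply: mf; rewrite inE.
have fle b s w : f b s w <= `|a s w|.
  rewrite ge_max normr_ge0 andbT.
  by case: b; rewrite ?expr0 ?expr1 ?mul1r ?mulN1r ?ler_norm// -normrN ler_norm.
have fi b s : P.-integrable setT (fun w => (f b s w)%:E).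
  apply: le_integrable (integrable_coord s) => //; first exact/measurable_EFinP.
  by move=> w _; rewrite /= lee_fin ger0_norm.
have ff s : (\int[P]_w (f false s w)%:E = \int[P]_w (f true s w)%:E)%E.
  have := mean0 s; rewrite unlock.
  under eq_integral do rewrite fE EFinB.
  rewrite (@integralB_EFin _ _ _ P setT (f false s) (f true s))//; do ?exact: fi.
  move/(congr1 (fun z => z + \int[P]_w (f true s w)%:E)%E); rewrite subeK ?add0e//.
  exact: integrable_fin_num.
have prodE b b' : (\int[P]_w (f b q w * f b' q' w)%:E =
    (\int[P]_w (f false q w)%:E) * (\int[P]_w (f false q' w)%:E))%E.
  have -> : (\int[P]_w (f b q w * f b' q' w)%:E = 'E_P[f b q] * 'E_P[f b' q'])%E.
    rewrite -expectationM_indep2//; first by rewrite unlock.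
    move=> A B mA mB; apply: (@indep_sigma_cylinders _ _ _ _ _ _ ind [set q]%SET [set q']%SET).
    - by rewrite finset.disjoints_subset finset.sub1set !inE.
    - by have := mf b q [set q]%SET (set11 q) measurableT A mA; rewrite setTI.
    - by have := mf b' q' [set q']%SET (set11 q') measurableT B mB; rewrite setTI.
  by rewrite unlock; congr (_ * _)%E; case: b; case: b'; rewrite ?ff.
have pfi b b' : P.-integrable setT (fun w => (f b q w * f b' q' w)%:E).
  apply: le_integrable (integrable_coord_prod q q') => //.
    by apply/measurable_EFinP; exact: measurable_funM.
  move=> w _; rewrite /= lee_fin !normrM ler_pM// ger0_norm//.
have -> : (\int[P]_w (a q w * a q' w)%:E =
  \int[P]_w ((f false q w * f false q' w + f true q w * f true q' w)%:E -
             (f false q w * f true q' w + f true q w * f false q' w)%:E))%E.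
  apply: eq_integral => w _; rewrite (fE q) (fE q') -EFinB; congr (_%:E); ring.
have pD b1 b1' b2 b2' : P.-integrable setT
    (fun w => (f b1 q w * f b1' q' w + f b2 q w * f b2' q' w)%:E).
  have := integrableD measurableT (pfi b1 b1') (pfi b2 b2').
  by apply: eq_integrable.
rewrite (@integralB_EFin _ _ _ P setT
  (fun w => f false q w * f false q' w + f true q w * f true q' w)
  (fun w => f false q w * f true q' w + f true q w * f false q' w))//; do ?exact: pD.
have intD b1 b1' b2 b2' :
    (\int[P]_w (f b1 q w * f b1' q' w + f b2 q w * f b2' q' w)%:E =
     \int[P]_w (f b1 q w * f b1' q' w)%:E + \int[P]_w (f b2 q w * f b2' q' w)%:E)%E.
  under eq_integral do rewrite EFinD.
  by rewrite integralD//; exact: pfi.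
have fin s : (\int[P]_w (f false s w)%:E)%E \is a fin_num.
  by apply: integrable_fin_num => //; exact: fi.
by rewrite !intD !prodE subee// fin_numD andbb fin_numM.
Qed.

Lemma integral_sqr_linform x : (\int[P]_w (linform x w ^+ 2)%:E = (\sum_q x q ^+ 2)%:E)%E.
Proof.
have -> : (\int[P]_w (linform x w ^+ 2)%:E = \int[P]_w
   (\sum_(z : I * I) (x z.1 * x z.2)%:E * (a z.1 w * a z.2 w)%:E))%E.
  apply: eq_integral => w _.
  rewrite expr2 /linform big_distrlr/= pair_big/= -sumEFin.
  by apply: eq_bigr => z _; rewrite -EFinM; congr (_%:E); ring.
rewrite integral_sum//; last first.
  by move=> z; apply: integrableZl => //; exact: integrable_coord_prod.
rewrite (eq_bigr (fun z : I * I => (if z.1 == z.2 then x z.1 * x z.2 else 0)%:E)); last first.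
  move=> z _; rewrite integralZl//; last exact: integrable_coord_prod.
  case: eqP => [->|/eqP zz]; last by rewrite integral_coord_prod// mule0.
  rewrite (eq_integral (fun w => (a z.2 w ^+ 2)%:E)) ?integral_sqr_coord ?mule1//.
rewrite sumEFin; congr (_%:E).
rewrite -(pair_big xpredT xpredT (fun i j => if i == j then x i * x j else 0))/=.
apply: eq_bigr => i _; rewrite (bigD1 i)//= eqxx big1 ?addr0//.
by move=> j ji; rewrite eq_sym (negbTE ji).
Qed.

End linear_forms.

(** * Concentration for a fixed tensor *)

Lemma measurable_set_ler (d : measure_display) (T : measurableType d) (R : realType)
    (f g : T -> R) : measurable_fun setT f -> measurable_fun setT g ->
  measurable [set w | f w <= g w].
Proof.
move=> mf mg; have /(_ measurableT [set true]) := measurable_fun_ler mf mg.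
by rewrite setTI; apply.
Qed.

Section concentration.
Context {d : measure_display} {T : measurableType d} {R : realType}.
Variable P : probability T R.
Context {I : finType}.
Variables (L : R) (a : I -> {RV P >-> R}).
Hypothesis ind : mutually_independent a.
Hypothesis mean0 : forall q, ('E_P[a q] = 0)%E.
Hypothesis var1 : forall q, ('V_P[a q] = 1)%E.
Hypothesis sg : forall q, subgaussian L (a q).

Context {m : nat}.
Variable b : I -> 'I_m.

(** [b] tells to which measurement an entry belongs, so this is the [p]-th measurement before
    division by the square root of [m]. *)
Definition block_form (x : I -> R) (p : 'I_m) : T -> R :=
  linform P a (fun q => if b q == p then x q else 0).

Definition sq_dev (x : I -> R) (w : T) : R := \sum_p (block_form x p w ^+ 2 - 1).

Lemma measurable_sq_dev x : measurable_fun setT (sq_dev x).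
Proof.
apply: measurable_sum => p; apply: measurable_funB => //; apply: measurable_funX.
exact: measurable_linform.
Qed.

Variable x : I -> R.
Hypothesis x1 : forall p, \sum_(q | b q == p) x q ^+ 2 = 1.

Lemma block_sumsq (s : R) p : \sum_q (s * (if b q == p then x q else 0)) ^+ 2 = s ^+ 2.
Proof.
rewrite -[RHS]mulr1 -(x1 p) mulr_sumr [RHS]big_mkcond/=; apply: eq_bigr => q _.
by case: ifP; rewrite ?mulr0 ?expr0n// exprMn.
Qed.

(** The fibres of [b] are disjoint, so the exponential factorizes; each factor is a centred square
    of a linear form that is again [L]-subgaussian with unit second moment. *)
Lemma mgf_sq_dev (l : R) : `|l| <= sg_kappa L / 2 ->
  (\int[P]_w (expR (l * sq_dev x w))%:E <= (expR (m%:R * (sg_C L * l ^+ 2)))%:E)%E.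
Proof.
move=> ll.
have -> : (\int[P]_w (expR (l * sq_dev x w))%:E =
   'E_P[fun w => (\prod_p expR (l * (block_form x p w ^+ 2 - 1)))%R])%E.
  by rewrite unlock; apply: eq_integral => w _; rewrite /sq_dev mulr_sumr expR_sum.
rewrite (expectation_prod_indep P a ind (fun p => [set q | b q == p]%SET)); last 3 first.
- move=> s s' ss'; rewrite -finset.setI_eq0; apply/eqP/finset.setP => q; rewrite !inE.
  by apply/negP => /andP[/eqP -> /eqP ss]; rewrite ss eqxx in ss'.
- move=> p; apply: measurableT_comp => //; apply: measurable_funM => //.
  apply: measurable_funB => //; apply: measurable_funX.
  by apply: measurable_linform_cylinders => q; rewrite inE => /negbTE ->.
- by move=> q w; exact: expR_ge0.
have -> : expR (m%:R * (sg_C L * l ^+ 2)) = \prod_(p < m) expR (sg_C L * l ^+ 2).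
  by rewrite prodr_const card_ord expRM_natl.
rewrite -prodEFin.
suff : (0 <= \prod_p 'E_P[fun w => expR (l * (block_form x p w ^+ 2 - 1))] <=
   \prod_(p < m) (expR (sg_C L * l ^+ 2))%:E)%E by case/andP.
elim/big_ind2 : _ => [|u1 u2 y1 y2 /andP[? ?] /andP[? ?]|p _].
- by rewrite lexx lee_fin ler01.
- by rewrite mule_ge0//= lee_pmul.
rewrite expectation_ge0/=; last by move=> w; exact: expR_ge0.
rewrite unlock; apply: integral_expR_centered_square => //.
- exact: measurable_linform.
- move=> s.
  have := mgf_linform P L a ind sg (fun q => s * (if b q == p then x q else 0)).
  rewrite block_sumsq mulrAC; apply: le_trans; rewrite le_eqVlt; apply/orP; left; apply/eqP.
  apply: eq_integral => w _; congr (expR _)%:E; rewrite /block_form /linform mulr_sumr.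
  by apply: eq_bigr => q _; rewrite mulrA.
- rewrite integral_sqr_linform//; congr (_%:E).
  by have := block_sumsq 1 p; rewrite expr1n => <-; apply: eq_bigr => q _; rewrite mul1r.
Qed.

(** Chernoff is applied at [c t] with [c = 2 sg_rate]. The first bound keeps [c t] in the admissible
    range for [t <= 1]; the second gives [C c ^+ 2 <= c / 2], so that half of the linear gain
    survives. *)
Definition sg_rate (K : R) : R := Num.min (sg_kappa K / 2) (sg_C K *+ 2)^-1 / 2.

Lemma sg_rate_gt0 K : 0 < sg_rate K.
Proof.
by rewrite divr_gt0// lt_min divr_gt0 ?sg_kappa_gt0//= invr_gt0 mulrn_wgt0// sg_C_gt0.
Qed.

Lemma tail_one_sided (t : R) (e : bool) : 0 < t <= 1 ->
  (P [set w | (m%:R * t <= (-1) ^+ e * sq_dev x w)%R] <=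
   (expR (- (sg_rate L * m%:R * t ^+ 2)))%:E)%E.
Proof.
move=> /andP[t0 t1].
pose S w := (-1) ^+ e * sq_dev x w.
have mS : measurable_fun setT S by apply: measurable_funM => //; exact: measurable_sq_dev.
pose S' : {RV P >-> R} := HB.pack S (isMeasurableFun.Build _ _ _ _ S mS).
pose c := sg_rate L * 2.
have c0 : 0 < c by rewrite mulr_gt0// sg_rate_gt0.
have cE : c = Num.min (sg_kappa L / 2) (sg_C L *+ 2)^-1 by rewrite /c /sg_rate divfK.
have ck : c <= sg_kappa L / 2 by rewrite cE ge_min lexx.
have cC : sg_C L * c <= 1 / 2.
  have : c <= (sg_C L *+ 2)^-1 by rewrite cE ge_min lexx orbT.
  have C0 := sg_C_gt0 L.
  rewrite -(ler_pM2l C0) => /le_trans; apply.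
  by rewrite le_eqVlt; apply/orP; left; apply/eqP; field; lra.
have l0 : 0 < c * t by rewrite mulr_gt0.
apply: le_trans (chernoff S' (m%:R * t) l0) _.
have : ('M_P S' (c * t) <= (expR (m%:R * (sg_C L * (c * t) ^+ 2)))%:E)%E.
  have -> : (c * t) ^+ 2 = ((-1) ^+ e * (c * t)) ^+ 2 by rewrite [RHS]exprMn sqrr_sign mul1r.
  apply: le_trans (mgf_sq_dev ((-1) ^+ e * (c * t)) _); last first.
    rewrite normrM normr_sign mul1r gtr0_norm//; nra.
  rewrite /mmt_gen_fun unlock le_eqVlt; apply/orP; left; apply/eqP.
  by apply: eq_integral => w _ /=; congr (expR _)%:E; rewrite /S; ring.
move=> h; apply: (@le_trans _ _ ((expR (m%:R * (sg_C L * (c * t) ^+ 2)))%:E *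
  (expR (- (c * t * (m%:R * t))))%:E)%E).
  by rewrite lee_wpmul2r// lee_fin expR_ge0.
rewrite -EFinM -expRD lee_fin ler_expR.
have -> : sg_rate L = c / 2 by rewrite /c mulfK.
have m0 : 0 <= m%:R :> R by [].
have t2 : 0 <= m%:R * t ^+ 2 :> R by rewrite mulr_ge0 ?sqr_ge0.
rewrite -subr_ge0.
have -> : - (c / 2 * m%:R * t ^+ 2) -
  (m%:R * (sg_C L * (c * t) ^+ 2) + - (c * t * (m%:R * t))) =
  (m%:R * t ^+ 2) * (c * (1 / 2 - sg_C L * c)) by field.
by rewrite mulr_ge0// mulr_ge0 ?(ltW c0)// subr_ge0.
Qed.

Lemma tail_two_sided (t : R) : 0 < t <= 1 ->
  (P [set w | (m%:R * t < `|sq_dev x w|)%R] <=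
   (2 * expR (- (sg_rate L * m%:R * t ^+ 2)))%:E)%E.
Proof.
move=> t01.
have msd := measurable_sq_dev x.
pose A (e : bool) := [set w | (m%:R * t <= (-1) ^+ e * sq_dev x w)%R].
have mA e : measurable (A e) by apply: measurable_set_ler => //; exact: measurable_funM.
have sub : [set w | (m%:R * t < `|sq_dev x w|)%R] `<=` A false `|` A true.
  move=> w /=; rewrite /A /= expr0 expr1 mul1r mulN1r => h.
  by have [s0|s0] := leP 0 (sq_dev x w); [left; rewrite -(ger0_norm s0) ltW|right; rewrite -(ltr0_norm s0) ltW].
have mB : measurable [set w | (m%:R * t < `|sq_dev x w|)%R].
  rewrite (_ : [set w | _] = ~` [set w | `|sq_dev x w| <= m%:R * t]).
    by apply: measurableC; apply: measurable_set_ler => //; exact: measurableT_comp.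
  by apply/seteqP; split=> w /=; rewrite ltNge; [move/negP|move=> /negP].
apply: (@le_trans _ _ (P (A false `|` A true))).
  by apply: le_measure => //; rewrite inE//; exact: measurableU.
apply: le_trans (measureU2 _ _ _) _ => //.
rewrite mulr_natl mulr2n EFinD; apply: leeD; exact: tail_one_sided.
Qed.

End concentration.

(** * Discrete Fourier transform and orthonormal factorization *)

Section complex_modulus.
Variable R : realType.
Implicit Types (z u v : R[i]).

Definition csq z : R := complex.Re z ^+ 2 + complex.Im z ^+ 2.

Lemma csqE z : real_complex R (csq z) = z * conjc z.
Proof.
case: z => x y; rewrite /csq/=; apply/eqP; rewrite eq_complex/=; apply/andP; split; apply/eqP; ring.
Qed.

Lemma csqM u v : csq (u * v) = csq u * csq v.
Proof. case: u v => [a b] [c d]; rewrite /csq /=; ring. Qed.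

End complex_modulus.
Arguments csq {R} z.

Section dft.
Variable R : realType.
Local Notation C := R[i].
Local Notation RC := (real_complex R).

Lemma dft_rootX n k : dft_root R n ^+ k =
  Complex (cos (k%:R * (2 * pi / n%:R))) (- sin (k%:R * (2 * pi / n%:R))).
Proof.
elim: k => [|k IH]; first by rewrite expr0 mul0r cos0 sin0 oppr0.
set t := 2 * pi / n%:R in IH *.
have -> : k.+1%:R * t = k%:R * t + t by rewrite -natr1 mulrDl mul1r.
rewrite exprS IH /dft_root cosD sinD -/t.
apply/eqP; rewrite eq_complex/=; apply/andP; split; apply/eqP; ring.
Qed.

Lemma cos_lt1 (x : R) : 0 < x < 2 * pi -> cos x < 1.
Proof.
move=> /andP[x0 x1].
have -> : x = (x / 2) *+ 2 by rewrite -mulr_natr divfK.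
have s0 : 0 < sin (x / 2) by apply: sin_gt0_pi; apply/andP; split; lra.
rewrite cos_mulr2n.
have := cos2Dsin2 (x / 2); nra.
Qed.

Lemma dft_root_neq1 n k : (0 < k < n)%N -> dft_root R n ^+ k != 1.
Proof.
move=> /andP[k0 kn]; have n0 : 0 < n%:R :> R by rewrite ltr0n (leq_trans _ kn).
rewrite dft_rootX eq_complex/= negb_and; apply/orP; left.
rewrite lt_eqF// cos_lt1//; have p0 := pi_gt0 R.
apply/andP; split.
  by apply: mulr_gt0; [rewrite ltr0n|apply: divr_gt0 => //; exact: mulr_gt0].
by rewrite mulrA ltr_pdivrMr// mulrC ltr_pM2l ?mulr_gt0// ltr_nat.
Qed.

Lemma dft_rootXn n : (0 < n)%N -> dft_root R n ^+ n = 1.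
Proof.
move=> n0; rewrite dft_rootX.
have -> : n%:R * (2 * pi / n%:R) = pi *+ 2 :> R.
  by rewrite mulrC divfK ?pnatr_eq0 -?lt0n// mulr_natl.
by rewrite cos2pi sin2pi oppr0.
Qed.

Lemma dft_root_conj n : dft_root R n * conjc (dft_root R n) = 1.
Proof.
by rewrite -csqE /csq /= sqrrN cos2Dsin2.
Qed.

(** A geometric sum with ratio [y] such that [y ^+ n = 1]; primitivity of the root gives [y != 1]
    off the diagonal. *)
Lemma dft_orthogonal n (k k' : 'I_n) :
  \sum_(l < n) dft_root R n ^+ (k * l) * conjc (dft_root R n) ^+ (k' * l) =
  (if k == k' then n%:R else 0 : C).
Proof.
set z := dft_root R n; set zb := conjc z.
have zz : z * zb = 1 := dft_root_conj n.
have n0 : (0 < n)%N by exact: leq_trans (ltn_ord k).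
under eq_bigr do rewrite !exprM -exprMn.
case: eqP => [->|kk'].
  under eq_bigr do rewrite -exprMn zz !expr1n.
  by rewrite sumr_const card_ord.
set y := z ^+ k * zb ^+ k'.
have zn : z ^+ n = 1 by exact: dft_rootXn.
have zbn : zb ^+ n = 1 by rewrite -rmorphXn zn rmorph1.
have y1 : y != 1.
  apply/eqP => y1.
  have zkk : z ^+ k = z ^+ k'.
    have := congr1 (fun u => u * z ^+ k') y1.
    by rewrite /y mul1r -mulrA -exprMn [zb * z]mulrC zz expr1n mulr1.
  have z0 : z != 0 by apply/eqP => z0; move/eqP: zz; rewrite z0 mul0r eq_sym oner_eq0.
  have contra (i j : 'I_n) : (i < j)%N -> z ^+ i = z ^+ j -> False.
    move=> ij zij; have /eqP h : z ^+ (j - i) != 1.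
      by apply: dft_root_neq1; rewrite subn_gt0 ij (leq_ltn_trans (leq_subr _ _)).
    have zi0 : z ^+ i != 0 by rewrite expf_neq0.
    apply: h; apply: (mulfI zi0); rewrite mulr1 -exprD subnKC ?(ltnW ij)//.
  case: (ltngtP k k') => h; [exact: (contra k k')|exact: (contra k' k)|].
  exact/kk'/val_inj.
have : (y - 1) * \sum_(l < n) y ^+ l = 0.
  by rewrite -subrX1 /y exprMn -!exprM ![(_ * n)%N]mulnC !exprM zn zbn !expr1n mulr1 subrr.
by move/eqP; rewrite mulf_eq0 subr_eq0 (negbTE y1)/= => /eqP.
Qed.

Variables n1 n2 n3 : nat.
Local Notation slices := ('I_n3 -> 'M[C]_(n1, n2)).
Hypothesis n3_gt0 : (0 < n3)%N.

Definition slice_sq (M : slices) : R := \sum_k \sum_i \sum_j csq (M k i j).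

(** The inverse Fourier transform in its unitary normalization. [dft_slice] is unnormalized, hence
    the same factor in [synth_dft]. *)
Definition synth (M : slices) (i : 'I_n1) (j : 'I_n2) (l : 'I_n3) : C :=
  RC (Num.sqrt n3%:R)^-1 * \sum_k M k i j * conjc (dft_root R n3) ^+ (k * l).

Let sn : (RC (Num.sqrt n3%:R)^-1) * (RC (Num.sqrt n3%:R)^-1) * n3%:R = 1 :> C.
Proof.
have s0 : Num.sqrt n3%:R != 0 :> R by rewrite gt_eqF// sqrtr_gt0 ltr0n.
have -> : n3%:R = RC n3%:R by rewrite rmorph_nat.
rewrite -!rmorphM -(rmorph1 RC) /=; congr RC.
by rewrite -{3}(@sqr_sqrtr _ (n3%:R : R))// expr2 mulrACA mulVf// mulr1.
Qed.

Lemma synth_dft (X : tensor R n1 n2 n3) i j l :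
  synth (fun k => (RC (Num.sqrt n3%:R)^-1) *: dft_slice X k) i j l = RC (X i j l).
Proof.
rewrite /synth.
under eq_bigr do rewrite !mxE -mulrA.
rewrite -mulr_sumr mulrA.
under eq_bigr do rewrite mulr_suml.
rewrite exchange_big/=.
under eq_bigr => l' _.
  rewrite (eq_bigr (fun k : 'I_n3 => RC (X i j l') *
    (dft_root R n3 ^+ (l' * k) * conjc (dft_root R n3) ^+ (l * k)))); last first.
    by move=> k _; rewrite -mulrA mulnC [(k * l)%N]mulnC.
  rewrite -mulr_sumr dft_orthogonal; over.
rewrite (bigD1 l)//= eqxx big1 ?addr0; last first.
  by move=> l' /negbTE ->; rewrite mulr0.
by rewrite mulrCA sn mulr1.
Qed.

#[local] Arguments conjc : simpl never.

Lemma synth_isometry (M : slices) :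
  \sum_i \sum_j \sum_l csq (synth M i j l) = slice_sq M.
Proof.
rewrite /slice_sq [RHS]exchange_big/=; apply: eq_bigr => i _.
rewrite [RHS]exchange_big/=; apply: eq_bigr => j _.
apply: (@complexI R); rewrite !rmorph_sum/=.
set w := dft_root R n3.
transitivity (\sum_(l < n3) (RC (Num.sqrt n3%:R)^-1) * (RC (Num.sqrt n3%:R)^-1) *
   \sum_k \sum_k' (M k i j * conjc (M k' i j)) * (w ^+ (k' * l) * conjc w ^+ (k * l))).
  apply: eq_bigr => l _; rewrite csqE /synth; set s := RC _.
  have sb : conjc s = s by exact: conjc_real.
  have cM (u v : C) : conjc (u * v) = conjc u * conjc v by exact: rmorphM.
  have cS (F : 'I_n3 -> C) : conjc (\sum_k F k) = \sum_k conjc (F k) by exact: rmorph_sum.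
  rewrite cM sb cS mulrACA.
  congr (_ * _); rewrite big_distrlr/=; apply: eq_bigr => k _; apply: eq_bigr => k' _.
  have cX (u : C) e : conjc (u ^+ e) = conjc u ^+ e by exact: rmorphXn.
  by rewrite cM cX conjcK; ring.
rewrite -mulr_sumr exchange_big/=.
rewrite (eq_bigr (fun k => n3%:R * RC (csq (M k i j)))); last first.
  move=> k _; rewrite exchange_big/= (bigD1 k)//= -mulr_sumr dft_orthogonal eqxx.
  rewrite big1 ?addr0; last first.
    by move=> k' kk; rewrite -mulr_sumr dft_orthogonal (negbTE kk) mulr0.
  by rewrite csqE mulrC.
by rewrite -mulr_sumr mulrA sn mul1r.
Qed.

End dft.

Section orthonormal_factorization.
Variable R : realType.
Local Notation C := R[i].

(** The square of the Frobenius norm. *)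
Definition fro m n (M : 'M[C]_(m, n)) : R := \sum_i \sum_j csq (M i j).

Lemma froE m n (M : 'M[C]_(m, n)) :
  real_complex R (fro m n M) = \tr (M *m (M ^t*)%sesqui).
Proof.
rewrite /mxtrace rmorph_sum; apply: eq_bigr => i _; rewrite mxE rmorph_sum.
by apply: eq_bigr => j _; rewrite !mxE; exact: csqE.
Qed.

(** Gram-Schmidt on [r] rows whose span contains the row space of [M] gives [V V^* = 1], so
    multiplication by [V] preserves the Frobenius norm. Always taking [r] rows, even at smaller
    rank, fixes the shape of the factors and the norm of [V]. *)
Lemma orthonormal_factorization n1 n2 r (M : 'M[C]_(n1, n2)) :
  (\rank M <= r)%N -> (r <= n2)%N ->
  exists (Q : 'M[C]_(n1, r)) (V : 'M[C]_(r, n2)),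
    [/\ M = Q *m V, fro _ _ Q = fro _ _ M & fro _ _ V = r%:R].
Proof.
move=> rM rn.
pose A : 'M[C]_(r, n2) := pid_mx r *m row_ebase M.
have MA : (M <= A)%MS.
  apply/submxP; exists (col_ebase M *m pid_mx (\rank M)).
  rewrite /A mulmxA -[X in X *m row_ebase M]mulmxA mul_pid_mx.
  by rewrite (minn_idPl rM) (minn_idPr rM) mulmx_ebase.
pose V := schmidt A.
have uV : V \is unitarymx by exact: schmidt_unitarymx.
have /submxP[Q MQ] : (M <= V)%MS by exact: submx_trans MA (schmidt_sub _).
have VV : V *m (V ^t*)%sesqui = 1%:M by exact/eqP.
exists Q, V; split => //; apply: (@complexI R); rewrite !froE.
- rewrite MQ trmx_mul map_mxM mulmxA -(mulmxA Q) VV mulmx1//.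
- by rewrite VV mxtrace1 rmorph_nat.
Qed.

End orthonormal_factorization.

(** * Rounding to a lattice *)

Section rounding.
Variable R : realType.

(** Rounding up with probability [th], the fractional part of [x / h], makes the error centred: the
    cross term with [e] averages out and the variance [h ^+ 2 th (1 - th)] is at most [h ^+ 2 / 4].
    One of the two choices does no worse than this average. *)
Lemma round_one (J : finType) (h x : R) (e w : J -> R) : 0 < h ->
  exists z : int, `|z%:~R - x / h| <= 1 /\
  \sum_j (e j + (x - h * z%:~R) * w j) ^+ 2 <=
  \sum_j e j ^+ 2 + h ^+ 2 / 4 * \sum_j w j ^+ 2.
Proof.
move=> h0; pose f : int := Num.floor (x / h); pose th := x / h - f%:~R.
have th0 : 0 <= th by rewrite subr_ge0 floor_le.
have th1 : th < 1 by rewrite ltrBlDl; have := floorD1_gt (x / h); rewrite intrD.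
have xE : x = h * (f%:~R + th) by rewrite /th; field; lra.
pose E := \sum_j e j ^+ 2; pose B := \sum_j e j * w j; pose W := \sum_j w j ^+ 2.
have W0 : 0 <= W by apply: sumr_ge0 => j _; exact: sqr_ge0.
have sumE t : \sum_j (e j + t * w j) ^+ 2 = E + t * 2 * B + t ^+ 2 * W.
  rewrite /E /B /W !mulr_sumr -!big_split/=; apply: eq_bigr => j _; ring.
rewrite -/E -/W.
have := sumE (x - h * f%:~R).
have := sumE (x - h * (f + 1)%:~R).
rewrite intrD.
have -> : x - h * f%:~R = h * th by rewrite xE; ring.
have -> : x - h * (f%:~R + 1) = h * (th - 1) by rewrite xE; ring.
set S1 := \sum_j (_ + h * (th - 1) * _) ^+ 2; set S0 := \sum_j _ ^+ 2 => hS1 hS0.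
have hh : 0 <= h ^+ 2 by exact: sqr_ge0.
have key : (1 - th) * S0 + th * S1 <= E + h ^+ 2 / 4 * W.
  rewrite hS0 hS1 -subr_ge0.
  have -> : E + h ^+ 2 / 4 * W - ((1 - th) * (E + h * th * 2 * B + (h * th) ^+ 2 * W) +
    th * (E + h * (th - 1) * 2 * B + (h * (th - 1)) ^+ 2 * W)) =
    h ^+ 2 * W * (th - 1 / 2) ^+ 2 by field.
  by rewrite mulr_ge0 ?sqr_ge0// mulr_ge0.
have [le0|lt0] := leP S0 (E + h ^+ 2 / 4 * W).
  exists f; split; first by rewrite distrC -/th ger0_norm// ltW.
  by have -> : x - h * f%:~R = h * th by rewrite xE; ring.
exists (f + 1); rewrite intrD; split.
  have -> : f%:~R + 1 - x / h = 1 - th by rewrite /th; ring.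
  by rewrite ger0_norm ?subr_ge0 ?(ltW th1)//; lra.
have -> : x - h * (f%:~R + 1) = h * (th - 1) by rewrite xE; ring.
rewrite leNgt; apply/negP => lt1; rewrite -/S1 in lt1; nra.
Qed.

(** Derandomized rounding, one coordinate at a time: the error accumulated so far becomes the [e] of
    the next step. Squared errors add without cross terms, so no operator norm of [w] enters. *)
Lemma round_vector (I J : finType) (h : R) (x : I -> R) (w : I -> J -> R) : 0 < h ->
  exists z : {ffun I -> int}, (forall i, `|(z i)%:~R - x i / h| <= 1) /\
  \sum_j (\sum_i (x i - h * (z i)%:~R) * w i j) ^+ 2 <=
  h ^+ 2 / 4 * \sum_i \sum_j w i j ^+ 2.
Proof.
move=> h0.
(* Default for the coordinates that the list does not reach, where the distance bound is required as
   well. *)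
have [z0 hz0] : exists z : {ffun I -> int}, forall i, `|(z i)%:~R - x i / h| <= 1.
  exists [ffun i => Num.floor (x i / h)] => i; rewrite ffunE distrC ger0_norm.
    by rewrite lerBlDl ltW//; have := floorD1_gt (x i / h); rewrite intrD.
  by rewrite subr_ge0 floor_le.
suff H (s : seq I) (e : J -> R) : uniq s -> exists z : {ffun I -> int},
    (forall i, `|(z i)%:~R - x i / h| <= 1) /\
    \sum_j (e j + \sum_(i <- s) (x i - h * (z i)%:~R) * w i j) ^+ 2 <=
    \sum_j e j ^+ 2 + h ^+ 2 / 4 * \sum_(i <- s) \sum_j w i j ^+ 2.
  have [z [hz1 hz2]] := H (index_enum I) (fun=> 0) (index_enum_uniq _).
  exists z; split => //; move: hz2; rewrite [X in _ <= X + _]big1 ?add0r; last first.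
    by move=> j _; rewrite expr0n.
  by under eq_bigr do rewrite add0r.
elim: s e => [|i s IH] e /=.
  move=> _; exists z0; split => //; rewrite big_nil mulr0 addr0.
  by under eq_bigr do rewrite big_nil addr0.
move=> /andP[iNs us].
have [zi [hzi1 hzi2]] := round_one J h (x i) e (w i) h0.
have [z [hz1 hz2]] := IH (fun j => e j + (x i - h * zi%:~R) * w i j) us.
exists [ffun k => if k == i then zi else z k]; split.
  by move=> k; rewrite ffunE; case: eqP => [->|].
rewrite [X in _ <= _ + _ * X]big_cons.
apply: le_trans (_ : _ <= \sum_j (e j + (x i - h * zi%:~R) * w i j) ^+ 2 +
   h ^+ 2 / 4 * \sum_(k <- s) \sum_j w k j ^+ 2) _; last by lra.
apply: le_trans hz2; rewrite le_eqVlt; apply/orP; left; apply/eqP.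
apply: eq_bigr => j _; congr (_ ^+ 2); rewrite big_cons ffunE eqxx addrA; congr (_ + _).
rewrite !big_seq; apply: eq_bigr => k ks; rewrite ffunE.
by case: eqP => // ki; rewrite -ki ks in iNs.
Qed.

End rounding.

(** * Counting integer vectors of bounded l1 norm *)

Section integer_vectors.

(** Lists all integer sequences of length [D] with l1 norm at most [K], [j] being the absolute value
    of the head. Zero occurs with both signs; the repetition is harmless for an upper bound on the
    size. *)
Definition int_list (D K : nat) : seq (seq int) :=
  iter D (fun F K => flatten [seq [seq s :: t | s <- [:: Posz j; - Posz j], t <- F (K - j)%N]
     | j <- iota 0 K.+1]) (fun=> [:: [::]]) K.

Lemma int_listS D K : int_list D.+1 K =
  flatten [seq [seq s :: t | s <- [:: Posz j; - Posz j], t <- int_list D (K - j)]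
     | j <- iota 0 K.+1].
Proof. by []. Qed.

Lemma mem_int_list (s : seq int) K : (\sum_(z <- s) `|z| <= K)%N ->
  s \in int_list (size s) K.
Proof.
elim: s K => [|z s IH] K; first by rewrite inE.
rewrite big_cons => zK; rewrite int_listS.
apply/flattenP; eexists; first apply/mapP.
  exists `|z|%N; last by [].
  by rewrite mem_iota add0n ltnS (leq_trans _ zK)// leq_addr.
apply: allpairs_f.
  by rewrite !inE; case: (z) => n /=; rewrite ?NegzE ?abszN ?absz_nat eqxx ?orbT.
by apply: IH; rewrite leq_subRL ?(leq_trans (leq_addr _ _) zK).
Qed.

(** Each coordinate costs a factor 4: 2 for the sign and 2 from the geometric sum over the remaining
    budget. *)
Lemma size_int_list D K : (size (int_list D K) <= 2 ^ (2 * D + K))%N.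
Proof.
elim: D K => [|D IH] K; first by rewrite /int_list /= expn_gt0.
rewrite int_listS size_flatten /shape -map_comp sumnE big_map.
rewrite (leq_trans (n := \sum_(j <- iota 0 K.+1) 2 * 2 ^ (2 * D + (K - j))))//.
  by apply: leq_sum => j _ /=; rewrite !size_cat !size_map addn0 addnn -mul2n leq_mul2l IH.
rewrite -[iota 0 K.+1]/(index_iota 0 K.+1).
rewrite big_nat_rev/= add0n.
rewrite (eq_big_nat _ _ (F2 := fun j : nat => (2 * 2 ^ (2 * D + j))%N)); last first.
  by move=> j /andP[_ jK]; rewrite subSS subKn.
have -> : (\sum_(0 <= j < K.+1) 2 * 2 ^ (2 * D + j) =
   2 * 2 ^ (2 * D) * \sum_(j < K.+1) 2 ^ j)%N.
  by rewrite big_mkord big_distrr/=; apply: eq_bigr => j _; rewrite expnD mulnA.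
have -> : (2 ^ (2 * D.+1 + K) = 2 * 2 ^ (2 * D) * 2 ^ K.+1)%N.
  by rewrite -[in X in (_ = X * _ * _)%N](expn1 2) -!expnD; congr expn; rewrite mulnS; lia.
rewrite leq_mul2l; apply/orP; right.
have := predn_exp 2 K.+1; rewrite /= mul1n => <-.
exact: leq_pred.
Qed.

Definition int_vectors (I : finType) (K : nat) : seq {ffun I -> int} :=
  [seq [ffun i => nth 0 s (enum_rank i)] | s <- int_list #|I| K].

Lemma size_int_vectors (I : finType) K : (size (int_vectors I K) <= 2 ^ (2 * #|I| + K))%N.
Proof. by rewrite size_map size_int_list. Qed.

Lemma mem_int_vectors (I : finType) K (z : {ffun I -> int}) :
  (\sum_i `|z i| <= K)%N -> z \in int_vectors I K.
Proof.
move=> zK; apply/mapP; exists [seq z i | i <- enum I]; last first.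
  apply/ffunP => i; rewrite ffunE (nth_map i) -?cardE ?ltn_ord//.
  by rewrite nth_enum_rank.
have -> : #|I| = size [seq z i | i <- enum I] by rewrite size_map -cardE.
by apply: mem_int_list; rewrite big_map big_enum.
Qed.

End integer_vectors.

Lemma sum_pair (V : nmodType) (I J : finType) (F : I * J -> V) :
  \sum_p F p = \sum_i \sum_j F (i, j).
Proof. by rewrite pair_bigA; apply: eq_bigr => -[]. Qed.

Section complex_rounding.
Variable R : realType.
Local Notation C := R[i].

(** A scaled Gaussian integer; the boolean selects the imaginary part. *)
Definition gauss_pt (I : Type) (h : R) (z : I * bool -> int) (i : I) : C :=
  Complex (h * (z (i, false))%:~R) (h * (z (i, true))%:~R).

Definition cpart (b : bool) (z : C) : R := if b then complex.Im z else complex.Re z.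

Lemma cpart_sum b (I : Type) (s : seq I) (F : I -> C) :
  cpart b (\sum_(i <- s) F i) = \sum_(i <- s) cpart b (F i).
Proof. by case: b; rewrite /cpart raddf_sum. Qed.

Lemma csq_cpart (z : C) : csq z = \sum_b cpart b z ^+ 2.
Proof. by rewrite big_bool/= addrC. Qed.

(** A complex coordinate is two real ones, with directions [W i] and its multiple by the imaginary
    unit; each [W i] counts twice, turning [h ^+ 2 / 4] into [h ^+ 2 / 2]. *)
Lemma round_complex (I J : finType) (h : R) (c : I -> C) (W : I -> J -> C) : 0 < h ->
  exists z : {ffun I * bool -> int},
    \sum_j csq (\sum_i (c i - gauss_pt I h z i) * W i j) <=
      h ^+ 2 / 2 * \sum_i \sum_j csq (W i j) /\
    \sum_q (z q)%:~R ^+ 2 <= 2 / h ^+ 2 * \sum_i csq (c i) + 4 * #|I|%:R.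
Proof.
move=> h0.
pose ib (b : bool) : C := if b then Complex 0 1 else 1.
pose x (q : I * bool) := cpart q.2 (c q.1).
pose w (q : I * bool) (p : J * bool) := cpart p.2 (ib q.2 * W q.1 p.1).
have [z [z1 z2]] := round_vector R (I * bool)%type (J * bool)%type h x w h0.
exists z; split.
  rewrite (_ : h ^+ 2 / 2 * _ = h ^+ 2 / 4 * \sum_q \sum_p w q p ^+ 2).
    apply: le_trans z2; rewrite le_eqVlt; apply/orP; left; apply/eqP.
    rewrite sum_pair/=.
    apply: eq_bigr => j _; rewrite csq_cpart; apply: eq_bigr => b' _; congr (_ ^+ 2).
    rewrite sum_pair/=.
    rewrite cpart_sum; apply: eq_bigr => i _.
    rewrite big_bool/=.
    rewrite /x /w /gauss_pt /cpart /=.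
    case: (c i) => cr ci; case: (W i j) => wr wi; case: b' => /=; ring.
  rewrite sum_pair/=.
  have -> : \sum_i \sum_b \sum_p w (i, b) p ^+ 2 = 2 * \sum_i \sum_j csq (W i j).
    rewrite mulr_sumr; apply: eq_bigr => i _.
    have wE b : \sum_p w (i, b) p ^+ 2 = \sum_j csq (W i j).
      rewrite sum_pair/=.
      apply: eq_bigr => j _; transitivity (csq (ib b * W i j)); first by rewrite csq_cpart.
      by rewrite csqM; case: b; rewrite /csq /= ?expr0n ?expr1n ?addr0 ?add0r mul1r.
    rewrite big_bool/=.
    by rewrite !wE; ring.
  by field.
have -> : 2 / h ^+ 2 * \sum_i csq (c i) + 4 * #|I|%:R =
    \sum_(q : I * bool) (2 * (x q / h) ^+ 2 + 2).
  have <- : \sum_(i : I) (4 : R) = 4 * #|I|%:R by rewrite sumr_const mulr_natr.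
  rewrite sum_pair mulr_sumr -big_split/=; apply: eq_bigr => i _.
  by rewrite big_bool/= csq_cpart big_bool/= /x/= !expr_div_n; ring.
apply: ler_sum => q _.
have := z1 q; rewrite ler_norml; set u := x q / h; set y := (z q)%:~R => hy.
have : (y - u) ^+ 2 <= 1 by nra.
(* This square is [2 u ^+ 2 + 2 (y - u) ^+ 2 - y ^+ 2]. *)
have := sqr_ge0 (y - 2 * u); nra.
Qed.

(** An integer is at most its square in absolute value, which turns the energy bound into the l1
    budget counted by [int_list]. *)
Lemma sum_absz_le (I : finType) (z : {ffun I -> int}) :
  (\sum_i `|z i|)%:R <= \sum_i (z i)%:~R ^+ 2 :> R.
Proof.
rewrite natr_sum; apply: ler_sum => i _.
rewrite -(@real_normK _ (z i)%:~R) ?num_real// -intr_norm -abszE /=.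
rewrite -[`|z i|%:~R]/(`|z i|%:R) -natrX ler_nat.
by case: `|z i|%N => // n; rewrite -[X in (X <= _)%N]expn1 leq_pexp2l.
Qed.

(** [S] indexes the rows of all [Q_k], or the columns of all [V_k]. Each of them meets the other
    factor separately, so the rounding problems are independent and only their bounds are summed. *)
Lemma round_family (S I J : finType) (h : R) (c : S -> I -> C) (W : S -> I -> J -> C) :
  0 < h ->
  exists z : {ffun S * (I * bool) -> int},
    let g s := gauss_pt I h (fun q => z (s, q)) in
    [/\ \sum_s \sum_j csq (\sum_i (c s i - g s i) * W s i j) <=
          h ^+ 2 / 2 * \sum_s \sum_i \sum_j csq (W s i j),
        (\sum_q `|z q|)%:R <=
          2 / h ^+ 2 * (\sum_s \sum_i csq (c s i)) + 4 * (#|S| * #|I|)%:R &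
        \sum_s \sum_i csq (g s i) <=
          2 * (\sum_s \sum_i csq (c s i)) + 4 * h ^+ 2 * (#|S| * #|I|)%:R].
Proof.
move=> h0.
have /fin_all_exists[Z hZ] : forall s, exists z : {ffun I * bool -> int},
    \sum_j csq (\sum_i (c s i - gauss_pt I h z i) * W s i j) <=
      h ^+ 2 / 2 * \sum_i \sum_j csq (W s i j) /\
    \sum_q (z q)%:~R ^+ 2 <= 2 / h ^+ 2 * \sum_i csq (c s i) + 4 * #|I|%:R.
  by move=> s; exact: round_complex.
pose z := [ffun p : S * (I * bool) => Z p.1 p.2].
have zE s : (fun q => z (s, q)) = Z s by apply/funext => q; rewrite ffunE.
have z2 : \sum_p (z p)%:~R ^+ 2 <= 2 / h ^+ 2 * (\sum_s \sum_i csq (c s i)) + 4 * (#|S| * #|I|)%:R.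
  rewrite sum_pair/=.
  have -> : 2 / h ^+ 2 * (\sum_s \sum_i csq (c s i)) + 4 * (#|S| * #|I|)%:R =
      \sum_s (2 / h ^+ 2 * (\sum_i csq (c s i)) + 4 * #|I|%:R).
    by rewrite big_split/= -mulr_sumr sumr_const -[_ *+ #|_|]mulr_natl natrM; congr (_ + _); ring.
  apply: ler_sum => s _; apply: le_trans (hZ s).2.
  by apply: ler_sum => q _; rewrite ffunE.
exists z; split => /=.
- rewrite mulr_sumr; apply: ler_sum => s _.
  by under eq_bigr do rewrite zE; exact: (hZ s).1.
- exact: le_trans (sum_absz_le _ _) z2.
- have -> : \sum_s \sum_i csq (gauss_pt I h (fun q => z (s, q)) i) =
     h ^+ 2 * \sum_p (z p)%:~R ^+ 2.
    rewrite sum_pair/= mulr_sumr.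
    apply: eq_bigr => s _.
    rewrite sum_pair/= mulr_sumr.
    apply: eq_bigr => i _.
    rewrite big_bool/=.
    by rewrite /csq /gauss_pt /=; ring.
  rewrite -(ler_pM2l (exprn_gt0 2 h0)) in z2; apply: le_trans z2 _.
  rewrite le_eqVlt; apply/orP; left; apply/eqP; field; lra.
Qed.

End complex_rounding.

(** * The net *)

Lemma net_count_arith (R : realType) (S u : R) : 0 <= u -> S <= 1 ->
  2 * (96 * u) * S + 4 * u <= 196 * u.
Proof. by move=> ? ?; nra. Qed.

Lemma net_size_arith (R : realType) (u : R) : 0 <= u -> 2 * u + u / 8 <= 3 * u.
Proof. by move=> ?; lra. Qed.

Section low_rank_net.
Variable R : realType.
Local Notation C := R[i].
Variables n1 n2 n3 r : nat.
Local Notation slices := ('I_n3 -> 'M[C]_(n1, n2)).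
Local Notation nsq := (slice_sq R n1 n2 n3).

Definition lowrank (M : slices) : Prop :=
  exists (Q : 'I_n3 -> 'M[C]_(n1, r)) (V : 'I_n3 -> 'M[C]_(r, n2)),
    M = fun k => Q k *m V k.

Let IQ : finType := ('I_n3 * 'I_n1 * ('I_r * bool))%type.
Let IV : finType := ('I_n3 * 'I_n2 * ('I_r * bool))%type.

(** Both steps make the rounding error exactly [1 / 64] in squared norm: [stepV ^+ 2 / 2] times
    [n2], using [|Q| ^+ 2 <= 1], and [stepQ ^+ 2 / 2] times [3 n1 r n3], using
    [|V'| ^+ 2 <= 3 r n3]. *)
Definition stepV : R := Num.sqrt (32 * n2%:R)^-1.
Definition stepQ : R := Num.sqrt (96 * (n1 * r * n3)%:R)^-1.

(** The budgets come from [2 |x| ^+ 2 / h ^+ 2] plus 4 per complex coordinate: [2 * 96 + 4 = 196]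
    for [Q] and [2 * 32 + 4 = 68] for [V]. *)
Definition net_codes : seq ({ffun IQ -> int} * {ffun IV -> int}) :=
  [seq (zQ, zV) | zQ <- int_vectors IQ (196 * (n1 * r * n3)),
                  zV <- int_vectors IV (68 * (n2 * r * n3))].

Definition decodeQ (z : {ffun IQ -> int}) (k : 'I_n3) : 'M[C]_(n1, r) :=
  \matrix_(i, j) gauss_pt R 'I_r stepQ (fun q => z ((k, i), q)) j.

Definition decodeV (z : {ffun IV -> int}) (k : 'I_n3) : 'M[C]_(r, n2) :=
  \matrix_(j, c) gauss_pt R 'I_r stepV (fun q => z ((k, c), q)) j.

Definition net_point (p : {ffun IQ -> int} * {ffun IV -> int}) : slices :=
  fun k => decodeQ p.1 k *m decodeV p.2 k.

Lemma size_net_codes : (size net_codes <= 2 ^ (200 * ((n1 + n2) * r * n3)))%N.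
Proof.
rewrite size_allpairs.
apply: leq_trans (leq_mul (size_int_vectors _ _) (size_int_vectors _ _)) _.
rewrite -expnD leq_exp2l// !card_prod !card_ord card_bool.
set u := (n1 * r * n3)%N; set v := (n2 * r * n3)%N.
have -> : (n3 * n1 * (r * 2) = 2 * u)%N by rewrite /u; lia.
have -> : (n3 * n2 * (r * 2) = 2 * v)%N by rewrite /v; lia.
have -> : ((n1 + n2) * r * n3 = u + v)%N by rewrite /u /v !mulnDl.
lia.
Qed.

Hypotheses (n1_gt0 : (0 < n1)%N) (n2_gt0 : (0 < n2)%N) (n3_gt0 : (0 < n3)%N).
Hypotheses (r_gt0 : (0 < r)%N) (r_le : (r <= n2)%N).

Lemma net_cover (M : slices) : lowrank M -> nsq M <= 1 ->
  exists p, p \in net_codes /\ exists e1 e2 : slices,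
    [/\ lowrank e1, lowrank e2, nsq e1 <= 1 / 64, nsq e2 <= 1 / 64 &
        M = fun k => net_point p k + (e1 k + e2 k)].
Proof.
move=> [Q0 [V0 ME]] M1.
have /fin_all_exists2[Q QE] : forall k, exists2 Q : 'M[C]_(n1, r), True &
    exists V : 'M[C]_(r, n2), [/\ M k = Q *m V, fro R _ _ Q = fro R _ _ (M k) & fro R _ _ V = r%:R].
  move=> k; have [||Q [V HQ]] := orthonormal_factorization R n1 n2 r (M k); last by exists Q => //; exists V.
    by rewrite ME (leq_trans (mxrankM_maxr _ _))// rank_leq_row.
  exact: r_le.
move=> /fin_all_exists[V HV].
have hV : 0 < stepV by rewrite sqrtr_gt0 invr_gt0 mulr_gt0 ?ltr0n.
have hV2 : stepV ^+ 2 = (32 * n2%:R)^-1 by rewrite sqr_sqrtr// invr_ge0 mulr_ge0.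
have hQ : 0 < stepQ by rewrite sqrtr_gt0 invr_gt0 mulr_gt0 ?ltr0n ?muln_gt0 ?n1_gt0 ?r_gt0.
have hQ2 : stepQ ^+ 2 = (96 * (n1 * r * n3)%:R)^-1 by rewrite sqr_sqrtr// invr_ge0 mulr_ge0.
have n20 : n2%:R != 0 :> R by rewrite pnatr_eq0 -lt0n.
have u0 : (n1 * r * n3)%:R != 0 :> R by rewrite pnatr_eq0 -lt0n !muln_gt0 n1_gt0 r_gt0.
have sumQ : \sum_k \sum_i \sum_j csq (Q k i j) <= 1.
  apply: le_trans M1; rewrite le_eqVlt; apply/orP; left; apply/eqP.
  by apply: eq_bigr => k _; have [_ + _] := HV k.
have sumV : \sum_k \sum_j \sum_c csq (V k j c) = (r * n3)%:R.
  rewrite (eq_bigr (fun=> r%:R)) => [|k _]; last by have [_ _ +] := HV k.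
  by rewrite sumr_const card_ord natrM mulr_natr.
have [zV [errV cntV sizV]] := round_family R ('I_n3 * 'I_n2)%type 'I_r 'I_n1 stepV
  (fun s j => V s.1 j s.2) (fun s j i => Q s.1 i j) hV.
have sumV' : \sum_(s : 'I_n3 * 'I_n2) \sum_j csq (V s.1 j s.2) = (r * n3)%:R.
  rewrite sum_pair -sumV; apply: eq_bigr => k _; exact: exchange_big.
have [zQ [errQ cntQ sizQ]] := round_family R ('I_n3 * 'I_n1)%type 'I_r 'I_n2 stepQ
  (fun s j => Q s.1 s.2 j) (fun s j c => decodeV zV s.1 j c) hQ.
have sumQ' : \sum_(s : 'I_n3 * 'I_n1) \sum_j csq (Q s.1 s.2 j) <= 1.
  by rewrite sum_pair.
have card1 : (#|{: 'I_n3 * 'I_n2}| * #|'I_r| = n2 * r * n3)%N.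
  by rewrite card_prod !card_ord mulnC mulnCA mulnC [(r * _)%N]mulnC.
have card2 : (#|{: 'I_n3 * 'I_n1}| * #|'I_r| = n1 * r * n3)%N.
  by rewrite card_prod !card_ord mulnC mulnCA mulnC [(r * _)%N]mulnC.
rewrite sumV' card1 hV2 in cntV sizV; rewrite card2 hQ2 in cntQ.
exists (zQ, zV); split.
  apply: allpairs_f; apply: mem_int_vectors.
    rewrite -(ler_nat R); apply: le_trans cntQ _; rewrite invrK (natrM _ 196).
    exact: net_count_arith.
  rewrite -(ler_nat R); apply: le_trans cntV _; rewrite invrK.
  rewrite le_eqVlt; apply/orP; left; apply/eqP; rewrite !natrM; ring.
exists (fun k => Q k *m (V k - decodeV zV k)), (fun k => (Q k - decodeQ zQ k) *m decodeV zV k).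
split.
- by exists Q, (fun k => V k - decodeV zV k).
- by exists (fun k => Q k - decodeQ zQ k), (decodeV zV).
- apply: le_trans (_ : _ <= stepV ^+ 2 / 2 * (n2%:R * 1)) _; last first.
    by rewrite hV2 le_eqVlt; apply/orP; left; apply/eqP; field.
  apply: le_trans (_ : _ <= stepV ^+ 2 / 2 * \sum_(s : 'I_n3 * 'I_n2) \sum_(j < r) \sum_(i < n1) csq (Q s.1 i j)) _.
    apply: le_trans errV; rewrite le_eqVlt; apply/orP; left; apply/eqP.
    rewrite /slice_sq sum_pair; apply: eq_bigr => k _; rewrite exchange_big/=.
    apply: eq_bigr => c _; apply: eq_bigr => i _; congr csq; rewrite mxE.
    by apply: eq_bigr => j _; rewrite !mxE mulrC.
  rewrite ler_wpM2l ?divr_ge0 ?sqr_ge0// sum_pair/=.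
  rewrite (eq_bigr (fun k => n2%:R * \sum_i \sum_j csq (Q k i j))) => [|k _]; last first.
    by rewrite sumr_const card_ord -[LHS]mulr_natl; congr (_ * _); exact: exchange_big.
  by rewrite -mulr_sumr ler_wpM2l.
- have V'3 : \sum_k \sum_j \sum_c csq (decodeV zV k j c) <= 3 * (r * n3)%:R.
    apply: le_trans (_ : _ <= 2 * (r * n3)%:R + 4 * (32 * n2%:R)^-1 * (n2 * r * n3)%:R) _.
      apply: le_trans sizV; rewrite le_eqVlt; apply/orP; left; apply/eqP.
      rewrite sum_pair/=; apply: eq_bigr => k _; rewrite exchange_big/=.
      by apply: eq_bigr => c _; apply: eq_bigr => j _; rewrite mxE.
    have -> : 4 * (32 * n2%:R)^-1 * (n2 * r * n3)%:R = (r * n3)%:R / 8 :> R.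
      by rewrite -mulnA (natrM _ n2); field.
    exact: net_size_arith.
  apply: le_trans (_ : _ <= stepQ ^+ 2 / 2 * (n1%:R * (3 * (r * n3)%:R))) _; last first.
    rewrite hQ2 le_eqVlt; apply/orP; left; apply/eqP; move: u0; rewrite -mulnA (natrM _ n1) => u0.
    by field; rewrite !pnatr_eq0 -!lt0n n1_gt0 r_gt0 n3_gt0.
  apply: le_trans (_ : _ <= stepQ ^+ 2 / 2 * \sum_(s : 'I_n3 * 'I_n1) \sum_(j < r) \sum_(c < n2) csq (decodeV zV s.1 j c)) _.
    apply: le_trans errQ; rewrite le_eqVlt; apply/orP; left; apply/eqP.
    rewrite /slice_sq sum_pair; apply: eq_bigr => k _.
    apply: eq_bigr => i _; apply: eq_bigr => c _; congr csq; rewrite mxE.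
    by apply: eq_bigr => j _; rewrite !mxE.
  rewrite ler_wpM2l ?divr_ge0 ?sqr_ge0// sum_pair/=.
  rewrite (eq_bigr (fun k => n1%:R * \sum_j \sum_c csq (decodeV zV k j c))) => [|k _]; last first.
    by rewrite sumr_const card_ord -[LHS]mulr_natl.
  by rewrite -mulr_sumr ler_wpM2l.
- apply/funext => k; have [-> _ _] := HV k.
  by rewrite /net_point /= mulmxBr mulmxBl subrKA addrC subrK.
Qed.

End low_rank_net.

(** * Absorbing the approximation error of a net *)

Section bilinear_net.
Variables (R : realType) (U : Type) (add : U -> U -> U) (sc : R -> U -> U).
Variables (B : U -> U -> R) (nsq : U -> R) (K N : set U).
Hypothesis BDl : forall u u' v, B (add u u') v = B u v + B u' v.
Hypothesis BDr : forall u v v', B u (add v v') = B u v + B u v'.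
Hypothesis BZl : forall c u v, B (sc c u) v = c * B u v.
Hypothesis BZr : forall c u v, B u (sc c v) = c * B u v.
Hypothesis KZ : forall c u, K u -> K (sc c u).
Hypothesis nsqZ : forall c u, nsq (sc c u) = c ^+ 2 * nsq u.
Hypothesis cover : forall u, K u -> nsq u <= 1 -> exists u', N u' /\ exists e1 e2,
  [/\ K e1, K e2, nsq e1 <= 1 / 64, nsq e2 <= 1 / 64 & u = add u' (add e1 e2)].

(* The supremum [s] of the form on the cone satisfies [s <= M + (9/16) s]. *)
Lemma bilinear_net_bound (M b : R) :
  (forall u v, K u -> K v -> nsq u <= 1 -> nsq v <= 1 -> `|B u v| <= b) ->
  (forall u v, N u -> N v -> `|B u v| <= M) ->
  forall u v, K u -> K v -> nsq u <= 1 -> nsq v <= 1 -> `|B u v| <= 3 * M.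
Proof.
move=> Bb BM u0 v0 Ku0 Kv0 u01 v01.
pose A := [set x : R | exists u v, [/\ K u, K v, nsq u <= 1, nsq v <= 1 & x = `|B u v|]].
have A0 : A `|B u0 v0| by exists u0, v0.
have supA : has_sup A.
  split; first by exists `|B u0 v0|.
  by exists b => _ [u [v [Ku Kv u1 v1 ->]]]; exact: Bb.
pose s := sup A.
have s_ub u v : K u -> K v -> nsq u <= 1 -> nsq v <= 1 -> `|B u v| <= s.
  by move=> Ku Kv u1 v1; apply: ub_le_sup; [case: supA|exists u, v].
(* An error has norm at most [1 / 8], so 8 times it is still an admissible argument of the
   supremum. *)
have n8 e : nsq e <= 1 / 64 -> nsq (sc 8 e) <= 1 by rewrite nsqZ => ?; lra.
have sl e v : K e -> nsq e <= 1 / 64 -> K v -> nsq v <= 1 -> `|B e v| <= s / 8.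
  move=> Ke e64 Kv v1; have := s_ub (sc 8 e) v (KZ _ _ Ke) Kv (n8 _ e64) v1.
  by rewrite BZl normrM ger0_norm//; lra.
have sr u e : K u -> nsq u <= 1 -> K e -> nsq e <= 1 / 64 -> `|B u e| <= s / 8.
  move=> Ku u1 Ke e64; have := s_ub u (sc 8 e) Ku (KZ _ _ Ke) u1 (n8 _ e64).
  by rewrite BZr normrM ger0_norm//; lra.
have slr e e' : K e -> nsq e <= 1 / 64 -> K e' -> nsq e' <= 1 / 64 -> `|B e e'| <= s / 64.
  move=> Ke e64 Ke' e'64; have := sl e (sc 8 e') Ke e64 (KZ _ _ Ke') (n8 _ e'64).
  by rewrite BZr normrM ger0_norm//; lra.
have s_le : s <= M + 9 / 16 * s.
  apply: ge_sup; first by exists `|B u0 v0|.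
  move=> _ [u [v [Ku Kv u1 v1 ->]]].
  have [u' [Nu' [e1 [e2 [Ke1 Ke2 e164 e264 uE]]]]] := cover u Ku u1.
  have [v' [Nv' [f1 [f2 [Kf1 Kf2 f164 f264 vE]]]]] := cover v Kv v1.
  (* The net points occur only in [B u' v']; every other term pairs elements of the cone. Four terms
     of size [s / 8] and four of size [s / 64] make [9 s / 16]. *)
  have BuvE : B u v = B u' v' + (B u f1 + B u f2) - (B e1 f1 + B e1 f2 + B e2 f1 + B e2 f2)
       + (B e1 v + B e2 v).
    by rewrite uE vE !(BDl, BDr); ring.
  have := BM u' v' Nu' Nv'.
  have := sr u f1 Ku u1 Kf1 f164; have := sr u f2 Ku u1 Kf2 f264.
  have := sl e1 v Ke1 e164 Kv v1; have := sl e2 v Ke2 e264 Kv v1.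
  have := slr e1 f1 Ke1 e164 Kf1 f164; have := slr e1 f2 Ke1 e164 Kf2 f264.
  have := slr e2 f1 Ke2 e264 Kf1 f164; have := slr e2 f2 Ke2 e264 Kf2 f264.
  by rewrite BuvE !ler_norml; lra.
(* From [7 s / 16 <= M] and [s >= 0] follows [s <= 16 M / 7 <= 3 M]. *)
have := s_ub u0 v0 Ku0 Kv0 u01 v01; have := normr_ge0 (B u0 v0); lra.
Qed.

End bilinear_net.

(** * Measurability and the TRIP constant *)

Section affine_constraints.
Context {d : measure_display} {T : measurableType d} {R : realType} {I : finType}.

(* An arbitrary intersection of half-spaces is closed: its complement is a
   countable union of open boxes with rational corners. *)
Lemma measurable_forall_affine (h : I -> T -> R) (D : set ((I -> R) * R)) :
  (forall i, measurable_fun setT (h i)) ->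
  measurable [set w | forall c, D c -> \sum_i c.1 i * h i w <= c.2].
Proof.
move=> mh.
pose V (y : I -> R) := exists2 c, D c & c.2 < \sum_i c.1 i * y i.
pose box (q : {ffun I -> rat * rat}) (y : I -> R) :=
  forall i, ratr (q i).1 <= y i /\ y i <= ratr (q i).2.
pose F q := [set w | box q (h ^~ w) /\ box q `<=` V].
have -> : [set w | forall c, D c -> \sum_i c.1 i * h i w <= c.2] = ~` (\bigcup_q F q).
  apply/seteqP; split=> w /=.
    move=> hw [q _ [bw qV]]; have [c Dc] := qV _ bw.
    by rewrite ltNge hw.
  move=> nF c Dc; rewrite leNgt; apply/negP => lt; apply: nF.
  pose g := \sum_i c.1 i * h i w - c.2; pose S := \sum_i `|c.1 i|.
  have g0 : 0 < g by rewrite subr_gt0.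
  have S0 : 0 <= S by apply: sumr_ge0.
  (* Moving every coordinate by at most [e] changes the linear form by at most [S e < g], so the
     violated constraint stays violated on the whole box. *)
  pose e := g / (S + 1).
  have e0 : 0 < e by rewrite divr_gt0// ltr_wpDl.
  have /fin_all_exists[q hq] : forall i, exists q : rat * rat,
      [/\ h i w - e <= ratr q.1, ratr q.1 <= h i w, h i w <= ratr q.2 & ratr q.2 <= h i w + e].
    move=> i; have [|q1 hq1] := @rat_in_itvoo R (h i w - e) (h i w); first by rewrite ltrBlDr ltrDl.
    have [|q2 hq2] := @rat_in_itvoo R (h i w) (h i w + e); first by rewrite ltrDl.
    move: hq1 hq2; rewrite !in_itv/= => /andP[a1 a2] /andP[b1 b2].
    by exists (q1, q2); split; exact: ltW.
  exists [ffun i => q i] => //; split; first by move=> i; rewrite ffunE; have [] := hq i.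
  move=> y by_; exists c => //.
  have : \sum_i c.1 i * (h i w - y i) <= S * e.
    rewrite /S mulr_suml; apply: ler_sum => i _.
    apply: le_trans (ler_norm _) _; rewrite normrM ler_wpM2l//.
    by have := by_ i; rewrite ffunE; have [h1 h2 h3 h4] := hq i => -[y1 y2]; rewrite ler_norml; lra.
  have SeE : S * e + e = g by rewrite /e; field; lra.
  under eq_bigr do rewrite mulrBr.
  rewrite big_split/= sumrN /g in SeE *; lra.
apply: measurableC; apply: countable_bigcupT_measurable; first exact: countableP.
move=> q; have [qV|qV] := pselect (box q `<=` V); last first.
  by rewrite (_ : F q = set0)//; apply/seteqP; split=> // w [].
rewrite (_ : F q = \bigcap_(i in [set: I])
  ([set w | ratr (q i).1 <= h i w] `&` [set w | h i w <= ratr (q i).2])); last first.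
  apply/seteqP; split=> w /=; first by move=> [bw _] i _; exact: bw.
  by move=> bw; split => // i; exact: bw.
apply: fin_bigcap_measurable; first exact: finite_finset.
by move=> i _; apply: measurableI; apply: measurable_set_ler.
Qed.

End affine_constraints.

(** * Deviation, polarization and attainment of the TRIP constant *)

Section tensors.
Variable R : realType.
Variables m n1 n2 n3 : nat.
Local Notation tens := (tensor R n1 n2 n3).
Implicit Types x y z : tens.

Definition addt x y : tens := fun i j l => x i j l + y i j l.
Definition sct (c : R) x : tens := fun i j l => c * x i j l.

Lemma sum3E (V : nmodType) (F : 'I_n1 -> 'I_n2 -> 'I_n3 -> V) :
  \sum_i \sum_j \sum_l F i j l = \sum_(q : 'I_n1 * 'I_n2 * 'I_n3) F q.1.1 q.1.2 q.2.
Proof. by rewrite sum_pair sum_pair. Qed.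

Lemma tinnerE x y : tinner x y = \sum_(q : 'I_n1 * 'I_n2 * 'I_n3) x q.1.1 q.1.2 q.2 * y q.1.1 q.1.2 q.2.
Proof. by rewrite /tinner sum3E. Qed.

Lemma frob_tinner x : frob_sq x = tinner x x.
Proof. by rewrite tinnerE /frob_sq sum3E; apply: eq_bigr => q _; rewrite expr2. Qed.

Lemma tinnerC x y : tinner x y = tinner y x.
Proof. by rewrite !tinnerE; apply: eq_bigr => q _; rewrite mulrC. Qed.

Lemma tinnerDr x y z : tinner x (addt y z) = tinner x y + tinner x z.
Proof. by rewrite !tinnerE -big_split; apply: eq_bigr => q _; rewrite mulrDr. Qed.

Lemma tinnerZr c x y : tinner x (sct c y) = c * tinner x y.
Proof. by rewrite !tinnerE mulr_sumr; apply: eq_bigr => q _; rewrite mulrCA. Qed.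

Lemma frob_ge0 x : 0 <= frob_sq x.
Proof. by rewrite /frob_sq sum3E; apply: sumr_ge0 => q _; exact: sqr_ge0. Qed.

Lemma tinner_sqr_le x y : tinner x y ^+ 2 <= frob_sq x * frob_sq y.
Proof.
rewrite !frob_tinner !tinnerE.
pose f (q : 'I_n1 * 'I_n2 * 'I_n3) := x q.1.1 q.1.2 q.2.
pose g (q : 'I_n1 * 'I_n2 * 'I_n3) := y q.1.1 q.1.2 q.2.
rewrite -/(f _) -/(g _).
have : 0 <= \sum_q \sum_q' (f q * g q' - f q' * g q) ^+ 2.
  by apply: sumr_ge0 => q _; apply: sumr_ge0 => q' _; exact: sqr_ge0.
have -> : \sum_q \sum_q' (f q * g q' - f q' * g q) ^+ 2 =
  2 * ((\sum_q f q * f q) * (\sum_q g q * g q)) - 2 * (\sum_q f q * g q) ^+ 2.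
  have -> : 2 * ((\sum_q f q * f q) * (\sum_q g q * g q)) - 2 * (\sum_q f q * g q) ^+ 2 =
     (\sum_q f q * f q) * (\sum_q g q * g q) + (\sum_q g q * g q) * (\sum_q f q * f q)
     - 2 * ((\sum_q f q * g q) * (\sum_q f q * g q)) by ring.
  rewrite !big_distrlr/= mulr_sumr -big_split/= -sumrB; apply: eq_bigr => q _.
  rewrite mulr_sumr -big_split/= -sumrB; apply: eq_bigr => q' _; ring.
lra.
Qed.

Variable A : 'I_m -> tens.

Definition pol x y : R := m%:R^-1 * (\sum_p tinner (A p) x * tinner (A p) y) - tinner x y.
Definition dev x : R := norm2_sq (meas_map A x) - frob_sq x.

Lemma norm2_meas x : norm2_sq (meas_map A x) = m%:R^-1 * \sum_p tinner (A p) x ^+ 2.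
Proof.
rewrite /norm2_sq mulr_sumr; apply: eq_bigr => p _.
by rewrite /meas_map exprMn exprVn sqr_sqrtr.
Qed.

Lemma dev_pol x : dev x = pol x x.
Proof.
by rewrite /dev /pol norm2_meas frob_tinner; congr (_ * _ - _).
Qed.

Lemma polC x y : pol x y = pol y x.
Proof. by rewrite /pol tinnerC; congr (_ * _ - _); apply: eq_bigr => p _; rewrite mulrC. Qed.

Lemma polDr x y z : pol x (addt y z) = pol x y + pol x z.
Proof.
rewrite /pol tinnerDr; under eq_bigr do rewrite tinnerDr mulrDr.
rewrite big_split/=; ring.
Qed.

Lemma polZr c x y : pol x (sct c y) = c * pol x y.
Proof.
rewrite /pol tinnerZr; under eq_bigr do rewrite tinnerZr mulrCA.
rewrite -mulr_sumr; ring.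
Qed.

Lemma polDl x y z : pol (addt x y) z = pol x z + pol y z.
Proof. by rewrite !(polC _ z) polDr. Qed.

Lemma polZl c x y : pol (sct c x) y = c * pol x y.
Proof. by rewrite !(polC _ y) polZr. Qed.

Lemma frobZ c x : frob_sq (sct c x) = c ^+ 2 * frob_sq x.
Proof. by rewrite !frob_tinner tinnerZr tinnerC tinnerZr; ring. Qed.

Lemma devZ c x : dev (sct c x) = c ^+ 2 * dev x.
Proof. by rewrite !dev_pol polZr polZl; ring. Qed.

Lemma devD x y : dev (addt x y) = dev x + 2 * pol x y + dev y.
Proof. by rewrite !dev_pol polDr !polDl (polC y x); ring. Qed.

Lemma frobD x y : frob_sq (addt x y) = frob_sq x + 2 * tinner x y + frob_sq y.
Proof.
by rewrite !frob_tinner tinnerDr !(tinnerC (addt x y)) !tinnerDr (tinnerC y x); ring.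
Qed.

(** Polarization [4 pol x y = dev (x + y) - dev (x - y)] combined with the parallelogram law for
    [frob_sq]. *)
Lemma pol_le_dev (t : R) x y :
  `|dev (addt x y)| <= t * frob_sq (addt x y) ->
  `|dev (addt x (sct (-1) y))| <= t * frob_sq (addt x (sct (-1) y)) ->
  `|pol x y| <= t / 2 * (frob_sq x + frob_sq y).
Proof.
rewrite !devD !frobD devZ frobZ polZr tinnerZr sqrrN expr1n !mul1r !ler_norml.
set a := tinner x y; set b := frob_sq x; set c := frob_sq y.
set e := dev x; set f := dev y; set g := pol x y.
move=> /andP[h1 h2] /andP[h3 h4]; apply/andP; split; lra.
Qed.

(** Cauchy-Schwarz for each measurement. The bound depends on [A] and serves qualitatively: it makes
    the supremum over the cone finite and the set defining [trip_const] nonempty. *)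
Lemma dev_bounded : exists2 b, 0 <= b & forall x, `|dev x| <= b * frob_sq x.
Proof.
pose b := m%:R^-1 * (\sum_p frob_sq (A p)) + 1.
exists b.
  by rewrite addr_ge0// mulr_ge0 ?invr_ge0// sumr_ge0// => p _; exact: frob_ge0.
move=> x; rewrite /dev; have f0 := frob_ge0 x.
have n0 : 0 <= norm2_sq (meas_map A x) by apply: sumr_ge0 => p _; exact: sqr_ge0.
have : norm2_sq (meas_map A x) <= m%:R^-1 * (\sum_p frob_sq (A p)) * frob_sq x.
  rewrite norm2_meas -mulrA ler_wpM2l ?invr_ge0// mulr_suml.
  by apply: ler_sum => p _; exact: tinner_sqr_le.
have : 0 <= m%:R^-1 * (\sum_p frob_sq (A p)) * frob_sq x.
  by rewrite mulr_ge0// mulr_ge0 ?invr_ge0// sumr_ge0// => p _; exact: frob_ge0.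
by rewrite /b mulrDl mul1r ler_norml; lra.
Qed.

(** The infimum is attained: the inequalities hold with [delta + e] for all [e > 0], and they are
    closed in the constant. *)
Lemma trip_const_leP (r : nat) (delta : R) : 0 <= delta ->
  trip_const r (meas_map A) <= delta <->
  (forall X : tens, (tubal_rank X <= r)%N ->
     (1 - delta) * frob_sq X <= norm2_sq (meas_map A X) <= (1 + delta) * frob_sq X).
Proof.
move=> d0; rewrite /trip_const; set S := [set _ | _].
have lbS : has_lbound S by exists 0 => e [].
split; last by move=> h; apply: ge_inf => //; split.
move=> le X rX.
(* The infimum of an empty set would be the default value 0, from which nothing follows. *)
have S0 : S !=set0.
  have [b b0 hb] := dev_bounded; exists b; split => // Y _.
  by have := hb Y; rewrite /dev ler_norml; lra.
have f0 := frob_ge0 X.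
suff H e : 0 < e -> (1 - (delta + e)) * frob_sq X <= norm2_sq (meas_map A X) <= (1 + (delta + e)) * frob_sq X.
  apply/andP; split; apply/ler_addgt0Pr => e e0.
    have /andP[+ _] := H (e / (frob_sq X + 1)) (divr_gt0 e0 (ltr_wpDl f0 ltr01)).
    have : e / (frob_sq X + 1) * frob_sq X <= e.
      by rewrite -mulrA ler_piMr ?(ltW e0)// mulrC ler_pdivrMr ?ltr_wpDl// mul1r lerDl.
    lra.
  have /andP[_] := H (e / (frob_sq X + 1)) (divr_gt0 e0 (ltr_wpDl f0 ltr01)).
  have : e / (frob_sq X + 1) * frob_sq X <= e.
    by rewrite -mulrA ler_piMr ?(ltW e0)// mulrC ler_pdivrMr ?ltr_wpDl// mul1r lerDl.
  lra.
move=> e0; have [c [c0 hc] ce] := @inf_adherent _ S e e0 (conj S0 lbS).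
have cde : c <= delta + e by rewrite (le_trans (ltW ce))// lerD2r.
by have := hc X rX; nra.
Qed.

End tensors.

(** * From the net to all low-rank tensors *)

Section deterministic_bound.
Variable R : realType.
Local Notation C := R[i].
Variables m n1 n2 n3 r : nat.
Hypotheses (n1_gt0 : (0 < n1)%N) (n2_gt0 : (0 < n2)%N) (n3_gt0 : (0 < n3)%N).
Hypotheses (r_gt0 : (0 < r)%N) (r_le : (r <= n2)%N).
Local Notation slices := ('I_n3 -> 'M[C]_(n1, n2)).
Local Notation tens := (tensor R n1 n2 n3).
Local Notation nsq := (slice_sq R n1 n2 n3).

Definition adds (M N : slices) : slices := fun k => M k + N k.
Definition scs (c : R) (M : slices) : slices := fun k => real_complex R c *: M k.
(** Slices without conjugate symmetry synthesize to a complex tensor; the real part ([false]) and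
    the imaginary part ([true]) are real tensors, to which the measurements apply. *)
Definition synth_part (b : bool) (M : slices) : tens :=
  fun i j l => cpart R b (synth R n1 n2 n3 M i j l).
Local Notation sp := synth_part.

Lemma synth_partD b M N : sp b (adds M N) = addt R n1 n2 n3 (sp b M) (sp b N).
Proof.
apply/funext => i; apply/funext => j; apply/funext => l; rewrite /synth_part /addt.
have -> : synth R n1 n2 n3 (adds M N) i j l = synth R n1 n2 n3 M i j l + synth R n1 n2 n3 N i j l.
  by rewrite /synth -mulrDr -big_split/=; congr (_ * _); apply: eq_bigr => k _; rewrite mxE mulrDl.
by case: b; rewrite /cpart raddfD.
Qed.

Lemma synth_partZ b c M : sp b (scs c M) = sct R n1 n2 n3 c (sp b M).
Proof.
apply/funext => i; apply/funext => j; apply/funext => l; rewrite /synth_part /sct.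
have -> : synth R n1 n2 n3 (scs c M) i j l = real_complex R c * synth R n1 n2 n3 M i j l.
  rewrite /synth mulrCA; congr (_ * _); rewrite mulr_sumr.
  by apply: eq_bigr => k _; rewrite mxE mulrA.
by case: (synth _ _ _ _ _ _ _ _) => x y; case: b; rewrite /cpart /=; ring.
Qed.

Lemma slice_sq_synth M : nsq M = \sum_b frob_sq (sp b M).
Proof.
rewrite -synth_isometry// big_bool /frob_sq !sum3E -big_split/=.
by apply: eq_bigr => q _; rewrite csq_cpart big_bool.
Qed.

Lemma slice_sqZ c M : nsq (scs c M) = c ^+ 2 * nsq M.
Proof.
by rewrite !slice_sq_synth mulr_sumr; apply: eq_bigr => b _; rewrite synth_partZ frobZ.
Qed.

Lemma slice_sqE M : nsq M = \sum_(q : 'I_n3 * 'I_n1 * 'I_n2) csq (M q.1.1 q.1.2 q.2).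
Proof. by rewrite /slice_sq sum3E. Qed.

Lemma slice_sq_sub (M N e1 e2 : slices) : M = adds N (adds e1 e2) ->
  nsq N <= 3 * (nsq M + (nsq e1 + nsq e2)).
Proof.
move=> ME; rewrite !slice_sqE -!big_split/= mulr_sumr; apply: ler_sum => q _.
rewrite ME /adds !mxE.
case: (N _ _ _) => a b; case: (e1 _ _ _) => c d; case: (e2 _ _ _) => e f.
rewrite /csq /=.
(* With [x] an entry of [M], [3 (x ^+ 2 + c ^+ 2 + e ^+ 2) - (x - c - e) ^+ 2] is the sum of these
   three squares; the next line treats the imaginary part. *)
have := sqr_ge0 ((a + (c + e)) + c); have := sqr_ge0 ((a + (c + e)) + e); have := sqr_ge0 (c - e).
have := sqr_ge0 ((b + (d + f)) + d); have := sqr_ge0 ((b + (d + f)) + f); have := sqr_ge0 (d - f).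
by lra.
Qed.

Definition sp_pair (b s : bool) (u v : slices) : tens :=
  addt R n1 n2 n3 (sp b u) (sct R n1 n2 n3 ((-1) ^+ s) (sp b v)).

(** Net points of squared norm at most 4 give [|B| <= t / 2 (4 + 4) = 4 t] on the net, and
    absorption costs a factor 3, whence 12. [X] enters through its normalized slices, on which [B]
    is [dev X]. *)
Lemma dev_lowrank (A : 'I_m -> tens) (t : R) : 0 <= t ->
  (forall p p' b s, p \in net_codes n1 n2 n3 r -> p' \in net_codes n1 n2 n3 r ->
     let x := sp_pair b s (net_point R n1 n2 n3 r p) (net_point R n1 n2 n3 r p') in
     `|dev R m n1 n2 n3 A x| <= t * frob_sq x) ->
  forall X : tens, (tubal_rank X <= r)%N -> `|dev R m n1 n2 n3 A X| <= 12 * t * frob_sq X.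
Proof.
move=> t0 good X rX.
pose B (M N : slices) := \sum_b pol R m n1 n2 n3 A (sp b M) (sp b N).
have Bdev (e : R) (u v : slices) : 0 <= e ->
    (forall b s, `|dev R m n1 n2 n3 A (sp_pair b s u v)| <= e * frob_sq (sp_pair b s u v)) ->
    `|B u v| <= e / 2 * (nsq u + nsq v).
  move=> e0 h; rewrite !slice_sq_synth -big_split/= mulr_sumr.
  apply: le_trans (ler_norm_sum _ _ _) _; apply: ler_sum => b _.
  apply: pol_le_dev; last exact: (h b true).
  have := h b false; rewrite /sp_pair (_ : sct _ _ _ _ _ (sp b v) = sp b v)//.
  by apply/funext => i; apply/funext => j; apply/funext => l; rewrite /sct expr0 mul1r.
have [bd bd0 hbd] := dev_bounded R m n1 n2 n3 A.
pose K := lowrank R n1 n2 n3 r.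
(* Codes may decode to long points. Those used by the cover have squared norm at most
   [3 (1 + 2 / 64) <= 4]. *)
pose N := [set u : slices | nsq u <= 4 /\ exists2 p, p \in net_codes n1 n2 n3 r & u = net_point R n1 n2 n3 r p].
have KZ c u : K u -> K (scs c u).
  move=> [Q [V ->]]; exists (fun k => real_complex R c *: Q k), V.
  by apply/funext => k; rewrite /scs scalemxAl.
have main u v : K u -> K v -> nsq u <= 1 -> nsq v <= 1 -> `|B u v| <= 3 * (4 * t).
  apply: (bilinear_net_bound R slices adds scs B nsq K N _ _ _ _ KZ slice_sqZ _ (4 * t) bd).
  - by move=> u1 u2 w; rewrite /B -big_split/=; apply: eq_bigr => b _; rewrite synth_partD polDl.
  - by move=> w u1 u2; rewrite /B -big_split/=; apply: eq_bigr => b _; rewrite synth_partD polDr.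
  - by move=> c u1 w; rewrite /B mulr_sumr; apply: eq_bigr => b _; rewrite synth_partZ polZl.
  - by move=> c u1 w; rewrite /B mulr_sumr; apply: eq_bigr => b _; rewrite synth_partZ polZr.
  - move=> w Kw w1; have [p [pN [e1 [e2 [Ke1 Ke2 e1s e2s wE]]]]] :=
      net_cover R n1 n2 n3 r n1_gt0 n2_gt0 n3_gt0 r_gt0 r_le w Kw w1.
    exists (net_point R n1 n2 n3 r p); split; last by exists e1, e2.
    split; last by exists p.
    apply: le_trans (slice_sq_sub _ _ _ _ wE) _; lra.
  - move=> w w' _ _ w1 w1'.
    apply: le_trans (Bdev bd w w' bd0 _) _; first by move=> b s; exact: hbd.
    nra.
  - move=> w w' [u4 [p pN pE]] [v4 [p' pN' pE']].
    apply: le_trans (Bdev t _ _ t0 _) _; last by nra.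
    by move=> b s; rewrite pE pE'; exact: good.
pose M : slices := fun k => (real_complex R (Num.sqrt n3%:R)^-1) *: dft_slice X k.
have KM : K M.
  have /fin_all_exists[Q HQ] : forall k, exists Q : 'M[C]_(n1, r), exists V : 'M[C]_(r, n2), M k = Q *m V.
    move=> k; have [||Q [V [-> _ _]]] := orthonormal_factorization R n1 n2 r (M k).
    - apply: leq_trans (mxrank_scale _ _) _; apply: leq_trans rX.
      exact: (leq_bigmax k).
    - exact: r_le.
    - by exists Q, V.
  have /fin_all_exists[V HV] := HQ.
  by exists Q, V; apply/funext => k; exact: HV.
have spM0 : sp false M = X.
  apply/funext => i; apply/funext => j; apply/funext => l.
  by rewrite /synth_part /M synth_dft.
(* The vanishing imaginary part is written as a multiple of [X], so that homogeneity disposes of its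
   terms. *)
have spM1 : sp true M = sct R n1 n2 n3 0 X.
  apply/funext => i; apply/funext => j; apply/funext => l.
  by rewrite /synth_part /M synth_dft// /sct mul0r.
have nM : nsq M = frob_sq X.
  by rewrite slice_sq_synth big_bool/= spM0 spM1 frobZ expr0n mul0r add0r.
have BM : B M M = dev R m n1 n2 n3 A X.
  by rewrite /B big_bool/= spM0 spM1 polZl mul0r add0r dev_pol.
have f0 := frob_ge0 R n1 n2 n3 X.
have BZ c : B (scs c M) (scs c M) = c ^+ 2 * B M M.
  by rewrite /B mulr_sumr; apply: eq_bigr => b _; rewrite synth_partZ polZl polZr mulrA expr2.
have [f00|fn0] := eqVneq (frob_sq X) 0.
  by have := hbd X; rewrite f00 !mulr0.
have fp : 0 < frob_sq X by rewrite lt_neqAle eq_sym fn0.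
pose c := (Num.sqrt (frob_sq X))^-1.
have c2 : c ^+ 2 * frob_sq X = 1 by rewrite exprVn sqr_sqrtr// mulVf.
have cM : nsq (scs c M) <= 1 by rewrite slice_sqZ nM c2.
have := main _ _ (KZ c _ KM) (KZ c _ KM) cM cM.
rewrite BZ BM normrM ger0_norm ?sqr_ge0// => h.
rewrite -(ler_pM2l (_ : 0 < c ^+ 2)); last by rewrite exprn_gt0// invr_gt0 sqrtr_gt0.
apply: le_trans h _.
have -> : c ^+ 2 * (12 * t * frob_sq X) = 12 * t * (c ^+ 2 * frob_sq X) by ring.
by rewrite c2; lra.
Qed.

End deterministic_bound.

(** * Random measurements and the union bound *)

Lemma measure_bigcup_seq_le (d : measure_display) (T : measurableType d) (R : realType)
    (P : probability T R) (K : eqType) (s : seq K) (B : K -> set T) (e : R) :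
  (forall k, measurable (B k)) -> (forall k, P (B k) <= e%:E)%E ->
  measurable [set w | exists2 k, k \in s & B k w] /\
  (P [set w | exists2 k, k \in s & B k w] <= ((size s)%:R * e)%:E)%E.
Proof.
move=> mB Be; elim: s => [|k s [mS IH]].
  rewrite (_ : [set w | _] = set0); first by rewrite measure0 mul0r.
  by apply/seteqP; split => // w [].
rewrite (_ : [set w | _] = B k `|` [set w | exists2 k, k \in s & B k w]); last first.
  apply/seteqP; split=> w /=.
    by case=> k' /[!inE] /orP[/eqP ->|k's] ?; [left|right; exists k'].
  by case=> [?|[k' k's ?]]; [exists k; rewrite ?mem_head|exists k'; rewrite ?inE ?k's ?orbT].
split; first exact: measurableU.
apply: le_trans (measureU2 _ _ _) _ => //.
have -> : (size (k :: s))%:R * e = e + (size s)%:R * e by rewrite /= -natr1; ring.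
by rewrite EFinD; apply: leeD; [exact: Be|exact: IH].
Qed.

Section random_measurements.
Context {R : realType} {L : R} {n1 n2 n3 m : nat}.
Context {d : measure_display} {T : measurableType d}.
Variable P : probability T R.
Variable a : 'I_m * 'I_n1 * 'I_n2 * 'I_n3 -> {RV P >-> R}.
Hypothesis ind : mutually_independent a.
Hypothesis mean0 : forall q, ('E_P[a q] = 0)%E.
Hypothesis var1 : forall q, ('V_P[a q] = 1)%E.
Hypothesis sg : forall q, subgaussian L (a q).
Hypothesis m_gt0 : (0 < m)%N.
Local Notation tens := (tensor R n1 n2 n3).

Definition ensemble (w : T) : 'I_m -> tens := fun p i j l => a (p, i, j, l) w.
Local Notation devw w := (dev R m n1 n2 n3 (ensemble w)).

(** [row] instantiates the block map [b], and [spread x] repeats [x] in every measurement, so all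
    blocks have the same norm. *)
Let row (q : 'I_m * 'I_n1 * 'I_n2 * 'I_n3) : 'I_m := q.1.1.1.
Let spread (x : tens) (q : 'I_m * 'I_n1 * 'I_n2 * 'I_n3) : R := x q.1.1.2 q.1.2 q.2.

Lemma sum_row (V : nmodType) (F : 'I_m * 'I_n1 * 'I_n2 * 'I_n3 -> V) p :
  \sum_(q | row q == p) F q = \sum_i \sum_j \sum_l F (p, i, j, l).
Proof.
rewrite big_mkcond/= !sum_pair/= (bigD1 p)//= [X in _ + X]big1 ?addr0.
  by apply: eq_bigr => i _; apply: eq_bigr => j _; apply: eq_bigr => l _; rewrite /row /= eqxx.
move=> p' pp'; apply: big1 => i _; apply: big1 => j _; apply: big1 => l _.
by rewrite /row /= (negbTE pp').
Qed.

Lemma block_form_tinner (x : tens) p w :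
  block_form P a row (spread x) p w = tinner (ensemble w p) x.
Proof.
rewrite /block_form /linform (eq_bigr (fun q => if row q == p then spread x q * a q w else 0)).
  rewrite -big_mkcond/= sum_row /tinner; apply: eq_bigr => i _; apply: eq_bigr => j _.
  by apply: eq_bigr => l _; rewrite /spread /= mulrC.
by move=> q _; case: ifP; rewrite ?mul0r.
Qed.

Lemma measurable_tinner (x : tens) p : measurable_fun setT (fun w => tinner (ensemble w p) x).
Proof.
rewrite (_ : (fun w => _) = block_form P a row (spread x) p); first exact: measurable_linform.
by apply/funext => w; rewrite block_form_tinner.
Qed.

Lemma measurable_dev (x : tens) : measurable_fun setT (fun w => devw w x).
Proof.
rewrite (_ : (fun w => _) =
  (fun w => m%:R^-1 * (\sum_p tinner (ensemble w p) x ^+ 2) - frob_sq x)); last first.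
  by apply/funext => w; rewrite /dev norm2_meas.
apply: measurable_funB => //; apply: measurable_funM => //.
by apply: measurable_sum => p; apply: measurable_funX; exact: measurable_tinner.
Qed.

Lemma measurable_dev_gt (x : tens) (t : R) :
  measurable [set w | t * frob_sq x < `|devw w x|].
Proof.
rewrite (_ : [set w | _] = ~` [set w | `|devw w x| <= t * frob_sq x]).
  apply: measurableC; apply: measurable_set_ler => //.
  by apply: measurableT_comp => //; exact: measurable_dev.
by apply/seteqP; split=> w /=; rewrite ltNge; [move/negP|move=> /negP].
Qed.

(** By homogeneity of [dev] and [frob_sq] the event is that of the normalized tensor. For
    [frob_sq x = 0] it is empty, since the deviation vanishes too. *)
Lemma tail_dev (x : tens) (t : R) : 0 < t <= 1 ->
  (P [set w | (t * frob_sq x < `|devw w x|)%R] <=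
   (2 * expR (- (sg_rate L * m%:R * t ^+ 2)))%:E)%E.
Proof.
move=> t01; have f0 := frob_ge0 R n1 n2 n3 x.
have [fz|fn0] := eqVneq (frob_sq x) 0.
  rewrite (_ : [set w | _] = set0) ?measure0 ?lee_fin ?mulr_ge0 ?expR_ge0//.
  apply/seteqP; split => // w /=; rewrite fz mulr0.
  by have [b _ /(_ x)] := dev_bounded R m n1 n2 n3 (ensemble w); rewrite fz mulr0 leNgt => /negP.
pose c := (Num.sqrt (frob_sq x))^-1; pose y := sct R n1 n2 n3 c x.
have c2 : c ^+ 2 * frob_sq x = 1 by rewrite exprVn sqr_sqrtr// mulVf.
have y1 : frob_sq y = 1 by rewrite frobZ.
have mR : 0 < m%:R :> R by rewrite ltr0n.
apply: le_trans (tail_two_sided P L a ind mean0 var1 sg row (spread y) _ t t01).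
  rewrite le_eqVlt; apply/orP; left; apply/eqP; congr (P _); apply/seteqP.
  have H w : (t * frob_sq x < `|devw w x|) = (m%:R * t < `|sq_dev P a row (spread y) w|).
    have -> : sq_dev P a row (spread y) w = m%:R * devw w y.
      rewrite /sq_dev sumrB sumr_const card_ord /dev norm2_meas y1 mulrBr mulVKf ?gt_eqF//.
      by rewrite mulr1; congr (_ - _); apply: eq_bigr => p _; rewrite block_form_tinner.
    rewrite normrM gtr0_norm// ltr_pM2l// devZ normrM ger0_norm ?sqr_ge0//.
    have c20 : 0 < c ^+ 2 by rewrite exprn_gt0// invr_gt0 sqrtr_gt0 lt_neqAle eq_sym fn0.
    by rewrite -(ltr_pM2l c20) mulrCA c2 mulr1.
  by split=> w /=; rewrite H.
move=> p; rewrite sum_row /spread/=; exact: y1.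
Qed.

(** The squared norm of the measurements is linear in the finitely many random variables [h q], the
    empirical second moments of pairs of entries. The condition is thus an uncountable family of
    affine constraints on them. *)
Lemma measurable_trip (r : nat) (delta : R) : 0 <= delta ->
  measurable [set w : T | trip_const r (meas_map (ensemble w)) <= delta].
Proof.
move=> d0; pose J : finType := ('I_n1 * 'I_n2 * 'I_n3)%type.
pose tq (x : tens) (q : J) := x q.1.1 q.1.2 q.2.
pose h (q : J * J) w := m%:R^-1 * \sum_p tq (ensemble w p) q.1 * tq (ensemble w p) q.2.
have normE (X : tens) w : norm2_sq (meas_map (ensemble w) X) =
    \sum_(q : J * J) (tq X q.1 * tq X q.2) * h q w.
  rewrite norm2_meas /h; under [RHS]eq_bigr do rewrite mulrCA.
  rewrite -mulr_sumr; congr (_ * _).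
  under [RHS]eq_bigr do rewrite mulr_sumr.
  rewrite exchange_big/=; apply: eq_bigr => p _.
  rewrite expr2 tinnerE big_distrlr/= pair_bigA/=; apply: eq_bigr => q _.
  by rewrite /tq; ring.
pose D : set ((J * J -> R) * R) := [set c | exists2 X : tens, (tubal_rank X <= r)%N &
  c = (fun q => tq X q.1 * tq X q.2, (1 + delta) * frob_sq X) \/
  c = (fun q => - (tq X q.1 * tq X q.2), - ((1 - delta) * frob_sq X))].
rewrite (_ : [set w | _] = [set w | forall c, D c -> \sum_q c.1 q * h q w <= c.2]).
  apply: measurable_forall_affine => q; apply: measurable_funM => //.
  by apply: measurable_sum => p; apply: measurable_funM.
apply/seteqP; split=> w /=; rewrite trip_const_leP//.
  move=> hw c [X rX cE]; have /andP[h1 h2] := hw X rX; rewrite normE in h1 h2.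
  case: cE => -> //=.
  by under eq_bigr do rewrite mulNr; rewrite sumrN lerN2.
move=> hw X rX; rewrite normE; apply/andP; split.
  have := hw (fun q => - (tq X q.1 * tq X q.2), - ((1 - delta) * frob_sq X)).
  rewrite /=; under eq_bigr do rewrite mulNr.
  by rewrite sumrN lerN2; apply; exists X => //; right.
have := hw (fun q => tq X q.1 * tq X q.2, (1 + delta) * frob_sq X).
by apply; exists X => //; left.
Qed.

End random_measurements.

(** * Choice of the constant and the probability count *)

Theorem theorem2 (R : realType) (L : R) (hL : 0 < L) :
  exists C : R, 0 < C /\
  forall (n1 n2 n3 r m : nat) (delta eta : R)
         (dd : measure_display) (T : measurableType dd) (P : probability T R)
         (a : 'I_m * 'I_n1 * 'I_n2 * 'I_n3 -> {RV P >-> R}),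
    (n1 <= n2)%N -> (1 <= r)%N -> (r <= n1)%N ->
    0 < delta < 1 -> 0 < eta < 1 ->
    mutually_independent a ->
    (forall q, ('E_P[a q] = 0)%E) ->
    (forall q, ('V_P[a q] = 1)%E) ->
    (forall q, subgaussian L (a q)) ->
    m%:R >= C * delta ^- 2 *
       Num.max ((r * r * n3 + n1 * r * n3 + n2 * r * n3)%:R * ln 2)
               (ln eta^-1) ->
    ((1 - eta)%:E <=
       P [set w : T | (trip_const r
            (meas_map (fun p i j l => a (p, i, j, l) w)) <= delta)%R])%E.
Proof.
have c0 := sg_rate_gt0 L; set c := sg_rate L in c0.
(* [144 = 12 ^ 2] comes from [t = delta / 12]. In 404, a part 400 pays for pairs of net codes, 3 for
   the four polarized tensors and the two tails, and 1 for [ln eta^-1]. *)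
exists (144 * 404 / c); split; first by rewrite divr_gt0.
move=> n1 n2 n3 r m delta eta dd T P a n12 r1 rn1 /andP[d0 d1] /andP[e0 e1] ind mean0 var1 sg hm.
have n1_gt0 : (0 < n1)%N by exact: leq_trans rn1.
have n2_gt0 : (0 < n2)%N by exact: leq_trans n12.
have rn2 : (r <= n2)%N by exact: leq_trans n12.
pose E := [set w : T | trip_const r (meas_map (ensemble P a w)) <= delta].
rewrite -[X in P X]/E.
(* For [n3 = 0] every tensor has norm zero and the event is certain; the net requires [n3 > 0]. *)
have [n30|n3_gt0] := posnP n3.
  have -> : E = setT.
    apply/seteqP; split => // w _; apply/trip_const_leP; first exact: ltW.
    move=> X _; have f0 : frob_sq X = 0.
      rewrite /frob_sq; apply: big1 => i _; apply: big1 => j _; apply: big1 => l _.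
      by exfalso; move: l; rewrite n30 => -[].
    have [b _ /(_ X)] := dev_bounded R m n1 n2 n3 (ensemble P a w).
    by rewrite /dev f0 !mulr0 subr0 ler_norml oppr0.
  by rewrite probability_setT lee_fin gerBl ltW.
set mu := Num.max _ _ in hm.
have le0 : 0 < ln eta^-1 by rewrite ln_gt0// invf_gt1.
have mu0 : 0 < mu by rewrite lt_max le0 orbT.
have mE : 404 * mu <= c * m%:R * (delta / 12) ^+ 2.
  have d2 : 0 < delta ^+ 2 by rewrite exprn_gt0.
  have -> : 404 * mu = c * (144 * 404 / c * delta ^- 2 * mu) * (delta / 12) ^+ 2.
    by field; rewrite !gt_eqF.
  by rewrite ler_wpM2r ?sqr_ge0// ler_wpM2l ?(ltW c0).
(* Positivity of [m] is forced by the sample size: [m = 0] would give [404 * mu <= 0]. *)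
have m_gt0 : (0 < m)%N.
  rewrite lt0n; apply/negP => /eqP m0; move: mE; rewrite m0 mulr0 mul0r; lra.
pose t := delta / 12.
have t01 : 0 < t <= 1 by rewrite /t; apply/andP; split; lra.
pose N := net_codes n1 n2 n3 r.
pose K := [seq (pp, bs) | pp <- [seq (p, p') | p <- N, p' <- N], bs <- enum {: bool * bool}].
pose pt k := sp_pair R n1 n2 n3 k.2.1 k.2.2 (net_point R n1 n2 n3 r k.1.1) (net_point R n1 n2 n3 r k.1.2).
pose Bad k := [set w | t * frob_sq (pt k) < `|dev R m n1 n2 n3 (ensemble P a w) (pt k)|].
have [mBad PBad] := @measure_bigcup_seq_le _ _ _ P _ K Bad _
  (fun k => measurable_dev_gt P a (pt k) t)
  (fun k => tail_dev P a ind mean0 var1 sg m_gt0 (pt k) t t01).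
set BB := [set w | _] in mBad PBad.
have mE' : measurable E by apply: measurable_trip; exact: ltW.
have sub : ~` BB `<=` E.
  move=> w nB; apply/trip_const_leP; first exact: ltW.
  move=> X rX.
  have : `|dev R m n1 n2 n3 (ensemble P a w) X| <= 12 * t * frob_sq X.
    apply: (dev_lowrank R m n1 n2 n3 r) => //; first by case/andP: t01 => /ltW.
    move=> p p' b s pN pN' /=; rewrite leNgt; apply/negP => lt; apply: nB.
    exists ((p, p'), (b, s)) => //.
    by apply: allpairs_f; [exact: allpairs_f|rewrite mem_enum].
  have -> : 12 * t = delta by rewrite /t; lra.
  by rewrite /dev ler_norml; lra.
apply: (@le_trans _ _ (P (~` BB))); last first.
  by apply: le_measure => //; rewrite inE//; exact: measurableC.
rewrite probability_setC// EFinB leeB//.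
apply: le_trans PBad _; rewrite lee_fin.
have sK : (size K <= 2 ^ (400 * ((n1 + n2) * r * n3) + 2))%N.
  rewrite 2!size_allpairs -cardE card_prod card_bool.
  have sN := size_net_codes n1 n2 n3 r; rewrite -/N in sN.
  apply: leq_trans (leq_mul (leq_mul sN sN) (leqnn _)) _.
  by rewrite -expnD -[(2 * 2)%N]/(2 ^ 2)%N -expnD leq_exp2l// leq_add2r -mulnDl.
set D := ((n1 + n2) * r * n3)%N in sK.
have D1 : (1 <= D)%N by rewrite !muln_gt0 addn_gt0 n1_gt0 r1.
set D' := (r * r * n3 + n1 * r * n3 + n2 * r * n3)%N in mu mu0 hm mE.
have DD' : (D <= D')%N by rewrite /D /D' !mulnDl -addnA leq_addl.
have l2 : 0 < ln 2 :> R by rewrite ln_gt0// ltr1n.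
have muD : D%:R * ln 2 <= mu.
  by rewrite le_max ler_pM2r// ler_nat DD'.
have mue : ln eta^-1 <= mu by rewrite le_max lexx orbT.
have D1' : 1 <= D%:R :> R by rewrite ler1n.
apply: (@le_trans _ _ ((2 ^ (400 * D + 2))%:R * (2 * expR (- (c * m%:R * t ^+ 2))))).
  by rewrite ler_wpM2r ?mulr_ge0 ?expR_ge0// ler_nat.
have -> : (2 ^ (400 * D + 2))%:R * (2 * expR (- (c * m%:R * t ^+ 2))) =
   expR ((400 * D + 3)%:R * ln 2 - c * m%:R * t ^+ 2).
  rewrite expRD expRM_natl lnK ?posrE// mulrA; congr (_ * _).
  by rewrite natrX -exprSr -addnS.
rewrite -[leRHS]lnK ?posrE// ler_expR -[ln eta]opprK -lnV ?posrE//.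
rewrite natrD natrM mulrDl -/t in mE *; nra.
Qed.
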